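(* Let $X$ be an EBP space. The functor $\mathfrak F_{\mathcal B}\colon\mathfrak{Mod}(\mathcal{ST})\to\mathfrak{Mod}(\mathcal B)$ restricts to an equivalence between the category of exact real-rank-zero-like $\mathcal{ST}$-modules and the category of exact $\mathcal B$-modules.
   Context: Compositions are written left to right: $fg$ means first $f$, then $g$. Spaces. For a finite $T_0$-space $X$, $\overline Y$ is the closure of $Y\subseteq X$ and $\widetilde Y$ the smallest open set containing $Y$. Write $x\le y$ if $\overline{\{x\}}\subseteq\overline{\{y\}}$, $x<y$ if moreover $x\neq y$, and $y\to x$ if $x<y$ and no $z$ satisfies $x<z<y$. A path from $y$ to $x$ is a sequence $(z_k)_{k=1}^n$ with $z_1=x$, $z_n=y$ and $z_{k+1}\to z_k$. $X$ is a unique path space if for all $x,y\in X$ there is at most one path from $y$ to $x$. $\mathbb{LC}(X)$ is the set of locally closed subsets. A boundary pair is a pair $(U,C)$ with $U=Y\setminus C$, $Y\in\mathbb{LC}(X)$, $U$ open in $Y$. It is elementary if $U$ and $C$ are connected, $U$ is open in $X$, $C$ is closed in $X$, $U\subseteq\widetilde C$ and $C\subseteq\overline U$. An EBP space is a unique path space in which every elementary boundary pair is of the form $(\widetilde{\{x\}},\overline{\{y\}})$ with $x\to y$. $\mathcal{ST}$-modules. An $\mathcal{ST}$-module $M$ consists of abelian groups $M(Y,j)$, $Y\in\mathbb{LC}(X)$, $j\in\{0,1\}$, and, for every $Y\in\mathbb{LC}(X)$, $U\subseteq Y$ relatively open and $C=Y\setminus U$, homomorphisms $i_U^Y\colon M(U,j)\to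 M(Y,j)$, $r_Y^C\colon M(Y,j)\to M(C,j)$, $\delta_C^U\colon M(C,j)\to M(U,1-j)$ ($j=0,1$), subject to: (1) $i_Y^Y=r_Y^Y=\mathrm{id}$; (2) if $Y,Z\in\mathbb{LC}(X)$ are topologically disjoint (disjoint, and both relatively open in $Y\cup Z$), then $r_{Y\cup Z}^Yi_Y^{Y\cup Z}+r_{Y\cup Z}^Zi_Z^{Y\cup Z}=\mathrm{id}$; (3) $i_U^Vi_V^Y=i_U^Y$ for $U\subseteq V\subseteq Y$ open in $Y$; (4) $r_Y^Dr_D^C=r_Y^C$ for $C\subseteq D\subseteq Y$ closed in $Y$; (5) $i_U^Yr_Y^C=r_U^{U\cap C}i_{U\cap C}^C$ for $U\subseteq Y$ open and $C\subseteq Y$ closed in $Y$; (6) $i_{C'}^C\delta_C^U=\delta_{C'}^U$ for a boundary pair $(U,C)$ and $C'\subseteq C$ open in $C$; (7) $\delta_C^Ur_U^{U'}=\delta_C^{U'}$ for a boundary pair $(U,C)$ and $U'\subseteq U$ closed in $U$; (8) $\delta_Y^{W\setminus Y}i_{W\setminus Y}^Z=r_Y^{W\setminus Z}\delta_{W\setminus Z}^Z$ whenever $Y,Z,W\in\mathbb{LC}(X)$, $Y\cup W\in\mathbb{LC}(X)$ contains $Y,W$ as closed subsets, $Z\cup W\in\mathbb{LC}(X)$ contains $Z,W$ as open subsets, and $W\subseteq Y\cup Z$. (Equivalently, $M$ is an additive functor to abelian groups from the universal pre-additive category $\mathcal{ST}$ on these generators and relations.) $M$ is exact if for all $Y\in\mathbb{LC}(X)$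 and $U\subseteq Y$ open, $C=Y\setminus U$, the cyclic six-term sequence formed by $i_U^Y,r_Y^C,\delta_C^U$ is exact; $M$ is real-rank-zero-like if all $\delta_C^U\colon M(C,0)\to M(U,1)$ vanish. $\mathcal B$-modules. A $\mathcal B$-module $N$ consists of abelian groups $N(\overline x_1),N(\widetilde x_0)$ ($x\in X$) and homomorphisms $r_{\overline x_1}^{\overline y_1}\colon N(\overline x_1)\to N(\overline y_1)$, $\delta_{\overline y_1}^{\widetilde x_0}\colon N(\overline y_1)\to N(\widetilde x_0)$, $i_{\widetilde x_0}^{\widetilde y_0}\colon N(\widetilde x_0)\to N(\widetilde y_0)$ for $x\to y$, with $\sum_{x\to y}r_{\overline x_1}^{\overline y_1}\delta_{\overline y_1}^{\widetilde x_0}=\sum_{z\to x}\delta_{\overline x_1}^{\widetilde z_0}i_{\widetilde z_0}^{\widetilde x_0}$ for all $x\in X$. It is exact if for all $x\in X$ the sequence $$N(\overline x_1)\xrightarrow{(r_{\overline x_1}^{\overline y_1},\,-\delta_{\overline x_1}^{\widetilde z_0})}\bigoplus_{x\to y}N(\overline y_1)\oplus\bigoplus_{z\to x}N(\widetilde z_0)\xrightarrow{(\delta_{\overline y_1}^{\widetilde x_0},\,i_{\widetilde z_0}^{\widetilde x_0})}N(\widetilde x_0)$$ is exact. Homomorphisms of modules are families of group homomorphisms commuting with all structure maps. The functor $\mathfrak F_{\mathcal B}$ sends $M$ to the $\mathcal B$-module with $\overline x_1\mapsto M(\overline{\{x\}},1)$, $\widetilde x_0\mapsto M(\widetilde{\{x\}},0)$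 and structure maps $r_{\overline{\{x\}}}^{\overline{\{y\}}}$, $\delta_{\overline{\{y\}}}^{\widetilde{\{x\}}}$, $i_{\widetilde{\{x\}}}^{\widetilde{\{y\}}}$. *)

(* Defs.v *)
From HB Require Import structures.
From mathcomp Require Import all_boot all_algebra.
From mathcomp Require Import boolp classical_sets cardinality topology.

Set Implicit Arguments.
Unset Strict Implicit.
Unset Printing Implicit Defensive.

Import GRing.Theory.
Local Open Scope classical_set_scope.
Local Open Scope ring_scope.

Record category := Category {
  obj :> Type;
  hom : obj -> obj -> Type;
  idm : forall a, hom a a;
  compm : forall a b c, hom a b -> hom b c -> hom a c;
  comp1m : forall a b (f : hom a b), compm (idm a) f = f;
  compm1 : forall a b (f : hom a b), compm f (idm b) = f;
  compmA : forall a b c d (f : hom a b) (g : hom b c) (h : hom c d),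
    compm f (compm g h) = compm (compm f g) h
}.
Arguments idm {_} a.
Arguments compm {_ a b c} f g.
Notation "f ;; g" := (compm f g) (at level 60, right associativity).

Record functor (C D : category) := Functor {
  fobj :> C -> D;
  fmap : forall a b, hom a b -> hom (fobj a) (fobj b);
  fmap1 : forall a, fmap (idm a) = idm (fobj a);
  fmapM : forall a b c (f : hom a b) (g : hom b c),
    fmap (f ;; g) = fmap f ;; fmap g
}.
Arguments fmap {C D} F {a b} f : rename.

Definition functor_id (C : category) : functor C C :=
  @Functor C C (fun a => a) (fun _ _ f => f) (fun=> erefl)
    (fun _ _ _ _ _ => erefl).

Program Definition functor_comp (C D E : category)
    (F : functor C D) (G : functor D E) : functor C E :=
  @Functor C E (fun a => G (F a)) (fun a b f => fmap G (fmap F f)) _ _.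
Next Obligation. by move=> *; rewrite /= !fmap1. Qed.
Next Obligation. by move=> *; rewrite /= !fmapM. Qed.

Definition is_iso (C : category) (a b : C) (f : hom a b) : Prop :=
  exists g : hom b a, f ;; g = idm a /\ g ;; f = idm b.

Definition naturally_isomorphic (C D : category) (F G : functor C D) : Prop :=
  exists eta : forall a : C, hom (F a) (G a),
    (forall a, is_iso (eta a)) /\
    (forall a b (f : hom a b), fmap F f ;; eta b = eta a ;; fmap G f).

Definition is_equivalence (C D : category) (F : functor C D) : Prop :=
  exists G : functor D C,
    naturally_isomorphic (functor_comp F G) (functor_id C) /\
    naturally_isomorphic (functor_comp G F) (functor_id D).

Definition full_subcategory (C : category) (P : C -> Prop) : category :=
  @Category {a : C | P a} (fun a b => hom (sval a) (sval b))
    (fun a => idm (sval a)) (fun a b c f g => f ;; g)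
    (fun a b => @comp1m C (sval a) (sval b))
    (fun a b => @compm1 C (sval a) (sval b))
    (fun a b c d => @compmA C (sval a) (sval b) (sval c) (sval d)).

Definition functor_restrict (C D : category) (F : functor C D)
    (P : C -> Prop) (Q : D -> Prop) (PQ : forall a, P a -> Q (F a)) :
    functor (full_subcategory P) (full_subcategory Q) :=
  @Functor (full_subcategory P) (full_subcategory Q)
    (fun a => exist Q (F (sval a)) (PQ (sval a) (svalP a)))
    (fun a b f => fmap F f)
    (fun a => fmap1 F (sval a))
    (fun a b c f g => fmapM F f g).

Definition restricts_to_equivalence (C D : category) (F : functor C D)
    (P : C -> Prop) (Q : D -> Prop) : Prop :=
  exists PQ : forall a, P a -> Q (F a), is_equivalence (functor_restrict PQ).

Lemma additive_eq (U V : zmodType) (f g : {additive U -> V}) :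
  f =1 g -> f = g.
Proof.
case: f g => [f [[fa]]] [g [[ga]]] /= /funext efg.
by move: fa ga; rewrite efg => fa ga; rewrite (Prop_irrelevance fa ga).
Qed.

#[short(type="finTopologicalType")]
HB.structure Definition FinTopological := {X of Finite X & Topological X}.

Section Spaces.
Context {X : finTopologicalType}.
Implicit Types (x y z : X) (Y Z U V C D : set X).

Definition open_hull Y : set X := smallest open Y.

Definition spec_le x y : Prop := closure [set x] `<=` closure [set y].
Definition spec_lt x y : Prop := spec_le x y /\ x <> y.

(* [arrow y x] is y -> x: note that y is the larger point. *)
Definition arrow y x : bool :=
  `[< spec_lt x y /\ ~ exists z, spec_lt x z /\ spec_lt z y >].

(* The sequence s = (z_1, ..., z_n) starts at the smaller point x = z_1. *)
Definition is_path y x (s : seq X) : Prop :=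
  if s is z1 :: s' then
    [/\ z1 = x, last z1 s' = y & path (fun a b => arrow b a) z1 s']
  else False.

Definition locally_closed Y : Prop :=
  exists U C, [/\ open U, closed C & Y = U `&` C].

(* Relative openness and closedness; both include the inclusion U `<=` Y. *)
Definition rel_open Y U : Prop := exists2 V, open V & U = Y `&` V.
Definition rel_closed Y C : Prop := exists2 D, closed D & C = Y `&` D.

Definition topologically_disjoint Y Z : Prop :=
  [/\ Y `&` Z = set0, rel_open (Y `|` Z) Y & rel_open (Y `|` Z) Z].

Definition boundary_pair U C : Prop :=
  exists Y, [/\ locally_closed Y, C `<=` Y, rel_open Y U & U = Y `\` C].

(* The library's [connected] holds for the empty set, which does not count as
   connected here: (set0, set0) is not an elementary boundary pair. *)
Definition elementary_boundary_pair U C : Prop :=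
  boundary_pair U C /\
  [/\ connected U /\ U !=set0, connected C /\ C !=set0, open U, closed C
    & U `<=` open_hull C /\ C `<=` closure U].

End Spaces.

Definition unique_path_space (X : finTopologicalType) : Prop :=
  forall (x y : X) s t, is_path y x s -> is_path y x t -> s = t.

Definition EBP_space (X : finTopologicalType) : Prop :=
  unique_path_space X /\
  forall U C : set X, elementary_boundary_pair U C ->
    exists x y, [/\ arrow x y, U = open_hull [set x] & C = closure [set y]].

Record LC (X : finTopologicalType) := MkLC {
  lc_set :> set X;
  lc_setP : locally_closed lc_set
}.

Section STModules.
Variable X : finTopologicalType.

(* The degree j in {0, 1} is a boolean (false = 0, true = 1), so that 1 - j is
   [~~ j].  Sets such as [U `&` C] that occur as indices in a relation are
   introduced as locally closed sets with a prescribed underlying set, and the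
   proofs of openness etc. required by the structure maps are universally
   quantified: they exist in all cases and are irrelevant. *)
Record st_module := STModule {
  st_obj :> LC X -> bool -> zmodType;
  st_i : forall (U Y : LC X) j,
    rel_open Y U -> {additive st_obj U j -> st_obj Y j};
  st_r : forall (Y C : LC X) j,
    rel_closed Y C -> {additive st_obj Y j -> st_obj C j};
  st_d : forall (C U : LC X) j,
    boundary_pair U C -> {additive st_obj C j -> st_obj U (~~ j)};
  st_i_id : forall (Y : LC X) j (h : rel_open Y Y) (m : st_obj Y j),
    st_i j h m = m;
  st_r_id : forall (Y : LC X) j (h : rel_closed Y Y) (m : st_obj Y j),
    st_r j h m = m;
  st_disjoint : forall (Y Z W : LC X) j,
    topologically_disjoint Y Z -> W = Y `|` Z :> set X ->
    forall (oY : rel_open W Y) (cY : rel_closed W Y)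
      (oZ : rel_open W Z) (cZ : rel_closed W Z) (m : st_obj W j),
    st_i j oY (st_r j cY m) + st_i j oZ (st_r j cZ m) = m;
  st_ii : forall (U V Y : LC X) j
    (oUV : rel_open V U) (oVY : rel_open Y V) (oUY : rel_open Y U)
    (m : st_obj U j),
    st_i j oVY (st_i j oUV m) = st_i j oUY m;
  st_rr : forall (Y D C : LC X) j
    (cD : rel_closed Y D) (cC : rel_closed D C) (cYC : rel_closed Y C)
    (m : st_obj Y j),
    st_r j cC (st_r j cD m) = st_r j cYC m;
  st_ir : forall (Y U C UC : LC X) j,
    UC = U `&` C :> set X ->
    forall (oU : rel_open Y U) (cC : rel_closed Y C)
      (cUC : rel_closed U UC) (oUC : rel_open C UC) (m : st_obj U j),
    st_r j cC (st_i j oU m) = st_i j oUC (st_r j cUC m);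
  st_id : forall (U C C' : LC X) j
    (b : boundary_pair U C) (oC' : rel_open C C') (b' : boundary_pair U C')
    (m : st_obj C' j),
    st_d j b (st_i j oC' m) = st_d j b' m;
  st_dr : forall (U C U' : LC X) j
    (b : boundary_pair U C) (cU' : rel_closed U U') (b' : boundary_pair U' C)
    (m : st_obj C j),
    st_r (~~ j) cU' (st_d j b m) = st_d j b' m;
  st_di : forall (Y Z W WY WZ : LC X) j,
    WY = W `\` Y :> set X -> WZ = W `\` Z :> set X ->
    locally_closed (Y `|` W) ->
    rel_closed (Y `|` W) Y -> rel_closed (Y `|` W) W ->
    locally_closed (Z `|` W) ->
    rel_open (Z `|` W) Z -> rel_open (Z `|` W) W ->
    W `<=` Y `|` Z ->
    forall (b : boundary_pair WY Y) (o : rel_open Z WY)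
      (c : rel_closed Y WZ) (b' : boundary_pair Z WZ) (m : st_obj Y j),
    st_i (~~ j) o (st_d j b m) = st_d j b' (st_r j c m)
}.

Record st_hom (M N : st_module) := STHom {
  st_fun :> forall Y j, {additive M Y j -> N Y j};
  st_fun_i : forall (U Y : LC X) j (h : rel_open Y U) (m : M U j),
    st_fun Y j (st_i M j h m) = st_i N j h (st_fun U j m);
  st_fun_r : forall (Y C : LC X) j (h : rel_closed Y C) (m : M Y j),
    st_fun C j (st_r M j h m) = st_r N j h (st_fun Y j m);
  st_fun_d : forall (C U : LC X) j (h : boundary_pair U C) (m : M C j),
    st_fun U (~~ j) (st_d M j h m) = st_d N j h (st_fun C j m)
}.

Lemma st_hom_eq (M N : st_module) (f g : st_hom M N) :
  (forall Y j, f Y j =1 g Y j) -> f = g.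
Proof.
case: f g => [f fi fr fd] [g gi gr gd] /= efg.
have {}efg : f = g.
  by apply: functional_extensionality_dep => Y;
     apply: functional_extensionality_dep => j; exact/additive_eq/efg.
move: fi fr fd gi gr gd; rewrite efg => *.
by congr STHom; exact: Prop_irrelevance.
Qed.

Definition st_hom_id (M : st_module) : st_hom M M :=
  @STHom M M (fun Y j => idfun) (fun _ _ _ _ _ => erefl)
    (fun _ _ _ _ _ => erefl) (fun _ _ _ _ _ => erefl).

Program Definition st_hom_comp (M N P : st_module)
    (f : st_hom M N) (g : st_hom N P) : st_hom M P :=
  @STHom M P (fun Y j => g Y j \o f Y j) _ _ _.
Next Obligation. by move=> *; rewrite /= !st_fun_i. Qed.
Next Obligation. by move=> *; rewrite /= !st_fun_r. Qed.
Next Obligation. by move=> *; rewrite /= !st_fun_d. Qed.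

Program Definition ModST : category :=
  @Category st_module st_hom st_hom_id st_hom_comp _ _ _.
Next Obligation. by move=> *; exact: st_hom_eq. Qed.
Next Obligation. by move=> *; exact: st_hom_eq. Qed.
Next Obligation. by move=> *; exact: st_hom_eq. Qed.

Definition st_exact (M : st_module) : Prop :=
  forall (U Y C : LC X) (o : rel_open Y U) (c : rel_closed Y C)
    (b : boundary_pair U C), C = Y `\` U :> set X ->
  forall j,
  [/\ forall m : M Y j, st_r M j c m = 0 <-> exists u, st_i M j o u = m,
      forall m : M C j, st_d M j b m = 0 <-> exists y, st_r M j c y = m
    & forall m : M U (~~ j),
        st_i M (~~ j) o m = 0 <-> exists x, st_d M j b x = m].

Definition st_real_rank_zero_like (M : st_module) : Prop :=
  forall (C U : LC X) (b : boundary_pair U C) (m : M C false),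
    st_d M false b m = 0.

End STModules.

Section BModules.
Variable X : finTopologicalType.

Record b_module := BModule {
  b1 : X -> zmodType;
  b0 : X -> zmodType;
  b_r : forall x y, arrow x y -> {additive b1 x -> b1 y};
  b_d : forall x y, arrow x y -> {additive b1 y -> b0 x};
  b_i : forall x y, arrow x y -> {additive b0 x -> b0 y};
  b_rel : forall x (n : b1 x),
    \sum_(y : {y | arrow x y}) b_d (valP y) (b_r (valP y) n) =
    \sum_(z : {z | arrow z x}) b_i (valP z) (b_d (valP z) n)
}.

Record b_hom (M N : b_module) := BHom {
  b_fun1 : forall x, {additive b1 M x -> b1 N x};
  b_fun0 : forall x, {additive b0 M x -> b0 N x};
  b_fun_r : forall x y (h : arrow x y) (m : b1 M x),
    b_fun1 y (b_r M h m) = b_r N h (b_fun1 x m);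
  b_fun_d : forall x y (h : arrow x y) (m : b1 M y),
    b_fun0 x (b_d M h m) = b_d N h (b_fun1 y m);
  b_fun_i : forall x y (h : arrow x y) (m : b0 M x),
    b_fun0 y (b_i M h m) = b_i N h (b_fun0 x m)
}.

Lemma b_hom_eq (M N : b_module) (f g : b_hom M N) :
  (forall x, b_fun1 f x =1 b_fun1 g x) ->
  (forall x, b_fun0 f x =1 b_fun0 g x) -> f = g.
Proof.
case: f g => [f f' fr fd fi] [g g' gr gd gi] /= e1 e0.
have {}e1 : f = g.
  by apply: functional_extensionality_dep => x; exact/additive_eq/e1.
have {}e0 : f' = g'.
  by apply: functional_extensionality_dep => x; exact/additive_eq/e0.
move: fr fd fi gr gd gi; rewrite e1 e0 => *.
by congr BHom; exact: Prop_irrelevance.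
Qed.

Definition b_hom_id (M : b_module) : b_hom M M :=
  @BHom M M (fun=> idfun) (fun=> idfun) (fun _ _ _ _ => erefl)
    (fun _ _ _ _ => erefl) (fun _ _ _ _ => erefl).

Program Definition b_hom_comp (M N P : b_module)
    (f : b_hom M N) (g : b_hom N P) : b_hom M P :=
  @BHom M P (fun x => b_fun1 g x \o b_fun1 f x)
    (fun x => b_fun0 g x \o b_fun0 f x) _ _ _.
Next Obligation. by move=> *; rewrite /= !b_fun_r. Qed.
Next Obligation. by move=> *; rewrite /= !b_fun_d. Qed.
Next Obligation. by move=> *; rewrite /= !b_fun_i. Qed.

Program Definition ModB : category :=
  @Category b_module b_hom b_hom_id b_hom_comp _ _ _.
Next Obligation. by move=> *; exact: b_hom_eq. Qed.
Next Obligation. by move=> *; exact: b_hom_eq. Qed.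
Next Obligation. by move=> *; exact: b_hom_eq. Qed.

(* An element of the finite direct sum in the middle is a pair (a, c) of
   families; exactness says that it is killed by the second map if and only if
   it comes from some n under the first one. *)
Definition b_exact (N : b_module) : Prop :=
  forall (x : X) (a : forall y : {y | arrow x y}, b1 N (val y))
    (c : forall z : {z | arrow z x}, b0 N (val z)),
  \sum_(y : {y | arrow x y}) b_d N (valP y) (a y) +
    \sum_(z : {z | arrow z x}) b_i N (valP z) (c z) = 0 <->
  exists n : b1 N x,
    (forall y : {y | arrow x y}, a y = b_r N (valP y) n) /\
    (forall z : {z | arrow z x}, c z = - b_d N (valP z) n).

End BModules.

Section Order.
Variable X : finTopologicalType.
Implicit Types (x y z w : X) (U C Y : set X).

Lemma open_nbhs_of U x : open U -> U x -> nbhs x U.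
Proof. by move=> oU Ux; apply: open_nbhs_nbhs. Qed.

Lemma spec_leP x y : spec_le x y <-> forall U, open U -> U x -> U y.
Proof.
split=> [xy U oU Ux|xy z].
  have /xy : closure [set x] x by exact: subset_closure.
  by move=> /(_ U (open_nbhs_of oU Ux))[_ [->]].
move=> zx B; rewrite nbhsE => -[U [oU Uz] UB].
exists y; split=> //; apply: UB; apply: (xy U oU).
by have [_ [->]] := zx U (open_nbhs_of oU Uz).
Qed.

Lemma spec_le_refl x : spec_le x x. Proof. by []. Qed.
Hint Resolve spec_le_refl : core.

Lemma spec_le_trans y x z : spec_le x y -> spec_le y z -> spec_le x z.
Proof. exact: subset_trans. Qed.

Lemma in_closure1 x z : closure [set x] z <-> spec_le z x.
Proof.
split=> [zx|]; last by apply; exact: subset_closure.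
apply/spec_leP => U oU Uz.
by have [_ [->]] := zx U (open_nbhs_of oU Uz).
Qed.

Lemma in_open_hull1 x z : open_hull [set x] z <-> spec_le x z.
Proof.
split=> [xz|/spec_leP xz U [oU /(_ x erefl) Ux]]; last exact: xz.
by apply/spec_leP => U oU Ux; apply: xz; split=> // _ ->.
Qed.

Lemma closed_down C :
  (forall x y, spec_le x y -> C y -> C x) -> closed C.
Proof.
move=> dC.
have -> : C = \bigcup_(y in C) closure [set y].
  apply/seteqP; split=> [y Cy|x [y Cy /in_closure1 xy]]; last exact: dC Cy.
  by exists y => //; exact: subset_closure.
apply: closed_bigcup => [|y _]; last exact: closed_closure.
exact: finite_finset.
Qed.

Lemma open_up U : (forall x y, spec_le x y -> U x -> U y) -> open U.
Proof.
move=> uU; rewrite -closedC; apply: closed_down => x y xy nUy Ux.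
exact/nUy/uU/Ux.
Qed.

Lemma open_hull1_open x : open (open_hull [set x]).
Proof.
apply: open_up => y z yz /in_open_hull1 xy.
by apply/in_open_hull1; exact: spec_le_trans yz.
Qed.

Lemma open_hull1_lc x : locally_closed (open_hull [set x]).
Proof.
exists (open_hull [set x]), setT; split; last by rewrite setIT.
- exact: open_hull1_open.
- exact: closedT.
Qed.

Lemma closure1_lc x : locally_closed (closure [set x]).
Proof.
exists setT, (closure [set x]); split; last by rewrite setTI.
- exact: openT.
- exact: closed_closure.
Qed.

Lemma convex_lc Y :
  (forall x y z, Y x -> Y z -> spec_le x y -> spec_le y z -> Y y) ->
  locally_closed Y.
Proof.
move=> cY; exists [set z | exists2 x, Y x & spec_le x z].
exists [set z | exists2 x, Y x & spec_le z x]; split.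
- apply: open_up => x y xy [z Yz zx].
  by exists z => //; exact: spec_le_trans xy.
- apply: closed_down => x y xy [z Yz yz].
  by exists z => //; exact: spec_le_trans yz.
- apply/seteqP; split=> [y Yy|y [[x Yx xy] [z Yz yz]]]; last exact: cY xy yz.
  by split; exists y.
Qed.

Lemma rel_open_open Y U : open U -> U `<=` Y -> rel_open Y U.
Proof. by move=> oU UY; exists U => //; rewrite setIidr. Qed.

Lemma rel_closed_closed Y C : closed C -> C `<=` Y -> rel_closed Y C.
Proof. by move=> oU UY; exists C => //; rewrite setIidr. Qed.

Lemma rel_open_up Y U : U `<=` Y ->
  (forall a b, Y b -> U a -> spec_le a b -> U b) -> rel_open Y U.
Proof.
move=> UY uU; exists [set b | exists2 a, U a & spec_le a b].
  apply: open_up => b c bc [a Ua ab].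
  by exists a => //; exact: spec_le_trans bc.
apply/seteqP; split=> [b Ub|b [Yb [a Ua ab]]]; last exact: uU ab.
by split; [exact: UY|exists b].
Qed.

Lemma rel_closed_down Y C : C `<=` Y ->
  (forall a b, Y a -> C b -> spec_le a b -> C a) -> rel_closed Y C.
Proof.
move=> CY dC; exists [set a | exists2 b, C b & spec_le a b].
  apply: closed_down => c a ca [b Cb ab].
  by exists b => //; exact: spec_le_trans ab.
apply/seteqP; split=> [a Ca|a [Ya [b Cb ab]]]; last exact: dC ab.
by split; [exact: CY|exists a].
Qed.

Lemma boundary_pair_open U C : open U -> U `&` C = set0 ->
  locally_closed (U `|` C) -> boundary_pair U C.
Proof.
move=> oU UC lc; exists (U `|` C); split=> //.
- by apply: rel_open_open.
- by rewrite setDUl setDv setU0; apply/esym/setDidl; rewrite UC.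
Qed.

Lemma rel_open_lc Y U : locally_closed Y -> rel_open Y U -> locally_closed U.
Proof.
move=> [V [C [oV cC ->]]] [W oW ->]; exists (V `&` W), C.
by split=> //; [exact: openI|rewrite setIAC].
Qed.

Lemma arrow_lt x y : arrow x y -> spec_lt y x.
Proof. by move=> /asboolP[]. Qed.

Lemma arrow_le x y : arrow x y -> spec_le y x.
Proof. by move=> /arrow_lt[]. Qed.

Hypothesis T0 : kolmogorov_space X.

Lemma spec_le_anti x y : spec_le x y -> spec_le y x -> x = y.
Proof.
move=> /spec_leP xy /spec_leP yx; apply: contrapT => /eqP /T0 [A].
case=> -[/set_mem + /set_mem nA]; rewrite nbhsE => -[U [oU Uz] UA].
- by apply/nA/UA/(xy U oU).
- by apply/nA/UA/(yx U oU).
Qed.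

Let e := (fun a b : X => arrow b a).

Lemma path_le x p : path e x p ->
  forall z, z \in x :: p -> spec_le x z /\ spec_le z (last x p).
Proof.
elim: p x => [|y p IH] x /=; first by move=> _ z; rewrite inE => /eqP ->.
move=> /andP[/arrow_le xy /[dup] yp /IH {}IH] z.
rewrite inE => /predU1P[->|/IH[yz zl]].
  split=> //; apply: spec_le_trans xy _.
  by have [] := IH y (mem_head _ _).
by split=> //; exact: spec_le_trans yz.
Qed.

Lemma path_exists x y : spec_le x y -> exists2 p, path e x p & last x p = y.
Proof.
pose I (a b : X) := [pred z : X | `[< spec_le a z /\ spec_le z b >]].
have [n] := ubnP #|I x y|; elim: n x y => // n IH x y; rewrite ltnS => In xy.
have [<-|nxy] := pselect (x = y); first by exists [::].
have [[z [[xz nxz] [zy nzy]]]|nz] :=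
    pselect (exists z, spec_lt x z /\ spec_lt z y); last first.
  exists [:: y] => //=; rewrite andbT; apply/asboolP; split=> //.
have [||p px pz] := IH x z.
- apply: leq_trans In; apply: proper_card; apply/properP; split.
    apply/fintype.subsetP => w; rewrite !inE => -[xw wz].
    by split=> //; exact: spec_le_trans wz zy.
  exists y; rewrite inE; first by [].
  by apply/asboolP => -[_ yz]; apply: nzy; exact: spec_le_anti.
- by [].
have [||q qz qy] := IH z y.
- apply: leq_trans In; apply: proper_card; apply/properP; split.
    apply/fintype.subsetP => w; rewrite !inE => -[zw wy].
    by split=> //; exact: spec_le_trans xz zw.
  exists x; rewrite inE; first by [].
  by apply/asboolP => -[zx _]; apply: nxz; exact: spec_le_anti.
- by [].
exists (p ++ q); first by rewrite cat_path px pz.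
by rewrite last_cat pz.
Qed.

Lemma arrow_below x y : spec_lt x y -> exists2 z, arrow z x & spec_le z y.
Proof.
move=> [/path_exists[[|z p] /=]]; first by move=> _ ->.
move=> /andP[xz zp] <- _; exists z => //.
by have [] := path_le zp (mem_head _ _).
Qed.

Lemma arrow_above x y : spec_lt x y -> exists2 z, arrow y z & spec_le x z.
Proof.
move=> [/path_exists[p]]; case/lastP: p => [|p z]; first by move=> _ /= ->.
rewrite last_rcons rcons_path => /andP[px lz] <- _; exists (last x p) => //.
by have [] := path_le px (mem_head _ _).
Qed.

Hypothesis UP : unique_path_space X.

Lemma path_unique x p q :
  path e x p -> path e x q -> last x p = last x q -> p = q.
Proof.
move=> xp xq pq; suff [] : x :: p = x :: q by [].
exact: (@UP x (last x p)).
Qed.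

Lemma arrow_above_inj x y y' z :
  arrow x y -> arrow x y' -> spec_le z y -> spec_le z y' -> y = y'.
Proof.
move=> xy xy' /path_exists[p zp py] /path_exists[q zq qy].
have : rcons p x = rcons q x.
  apply: (@path_unique z); rewrite ?last_rcons // rcons_path.
    by rewrite zp /e py.
  by rewrite zq /e qy.
by move=> /rcons_inj[pq]; rewrite -py pq.
Qed.

Lemma arrow_below_inj x y y' z :
  arrow y x -> arrow y' x -> spec_le y z -> spec_le y' z -> y = y'.
Proof.
move=> xy xy' /path_exists[p yp pz] /path_exists[q yq qz].
suff [] : y :: p = y' :: q by [].
by apply: (@path_unique x); rewrite /= ?pz //; apply/andP; split.
Qed.

Lemma interval_total b a m w : spec_le b m -> spec_le m a ->
  spec_le b w -> spec_le w a -> spec_le w m \/ spec_le m w.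
Proof.
move=> /path_exists[p bp pm] /path_exists[q mq qa].
move=> /path_exists[p' bp' pw] /path_exists[q' wq' qa'].
have epq : p ++ q = p' ++ q'.
  apply: (@path_unique b); rewrite ?cat_path ?last_cat ?bp ?bp' ?pm ?pw //.
  by rewrite qa qa'.
have : w \in b :: p ++ q.
  rewrite epq -cat_cons mem_cat -pw.
  by rewrite mem_last.
rewrite -cat_cons mem_cat => /orP[/(path_le bp)[_]|wq].
  by rewrite pm; left.
by right; have [] := path_le mq (_ : w \in m :: q); rewrite // inE wq orbT.
Qed.

Lemma star_lc x : locally_closed (open_hull [set x] `|` closure [set x]).
Proof.
apply: convex_lc => b w a.
move=> [/in_open_hull1 xb _ bw _|/in_closure1 bx].
  by left; apply/in_open_hull1; exact: spec_le_trans bw.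
move=> [/in_open_hull1 xa|/in_closure1 ax] bw wa; last first.
  by right; apply/in_closure1; exact: spec_le_trans ax.
have [wx|xw] := interval_total bx xa bw wa.
- by right; apply/in_closure1.
- by left; apply/in_open_hull1.
Qed.

Lemma arrow_lc x y : arrow x y ->
  locally_closed (open_hull [set x] `|` closure [set y]).
Proof.
move=> xy; have yx := arrow_le xy; apply: convex_lc => b w a.
move=> [/in_open_hull1 xb _ bw _|/in_closure1 bY].
  by left; apply/in_open_hull1; exact: spec_le_trans bw.
move=> [/in_open_hull1 xa|/in_closure1 ay] bw wa; last first.
  by right; apply/in_closure1; exact: spec_le_trans ay.
have [wy|yw] := interval_total bY (spec_le_trans yx xa) bw wa.
  by right; apply/in_closure1.
have [wx|xw] := interval_total (spec_le_trans bY yx) xa bw wa; last first.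
  by left; apply/in_open_hull1.
have [wx'|nwx] := pselect (w = x); first by left; apply/in_open_hull1; rewrite wx'.
have [wy'|nyw] := pselect (y = w); first by right; apply/in_closure1; rewrite wy'.
by move: xy => /asboolP[_]; case; exists w.
Qed.

Lemma arrow_boundary_pair_sets x y : arrow x y ->
  boundary_pair (open_hull [set x]) (closure [set y]).
Proof.
move=> xy; apply: boundary_pair_open; first exact: open_hull1_open.
  rewrite -subset0 => z [/in_open_hull1 xz /in_closure1 zy].
  have [yx] := arrow_lt xy; apply.
  by apply: spec_le_anti => //; exact: spec_le_trans zy.
exact: arrow_lc.
Qed.

End Order.

Section FunctorB.
Variable X : finTopologicalType.
Implicit Types (x y z w : X).

Definition cl x : LC X := MkLC (closure1_lc x).
Definition up x : LC X := MkLC (open_hull1_lc x).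

Lemma arrow_rel_closed x y : arrow x y -> rel_closed (cl x) (cl y).
Proof.
move=> xy; apply: rel_closed_closed; first exact: closed_closure.
exact: arrow_le.
Qed.

Lemma arrow_rel_open x y : arrow x y -> rel_open (up y) (up x).
Proof.
move=> xy; apply: rel_open_open => [|z /in_open_hull1 xz].
  exact: open_hull1_open.
by apply/in_open_hull1; apply: spec_le_trans xz; exact: arrow_le.
Qed.

Lemma st_set0 (M : st_module X) j (V : LC X) (m : M V j) :
  V = set0 :> set X -> m = 0.
Proof.
move=> V0.
have o : rel_open V V by exists setT; [exact: openT|rewrite setIT].
have c : rel_closed V V by exists setT; [exact: closedT|rewrite setIT].
have VV : V = V `|` V :> set X by rewrite setUid.
have d : topologically_disjoint V V by split; rewrite -?VV // V0 setI0.
have := st_disjoint d VV o c o c m.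
by rewrite !st_r_id !st_i_id => /(canRL (addrK _)); rewrite subrr.
Qed.

Section Split.
Variables (M : st_module X) (j : bool) (I : finType) (W : LC X).
Variable Y : I -> LC X.
Hypothesis disjY : forall i k, i != k -> Y i `&` Y k = set0.
Hypotheses (oY : forall i, rel_open W (Y i)) (cY : forall i, rel_closed W (Y i)).

Let US (s : seq I) : set X := [set x | exists2 i, i \in s & (Y i : set X) x].

Let US_sub s : US s `<=` W.
Proof. by move=> x [i _]; case: (oY i) => V _ -> []. Qed.

Let US_open s : rel_open W (US s).
Proof.
apply: rel_open_up => [|a b Wb [i si]]; first exact: US_sub.
case: (oY i) => V oV eV; rewrite eV => -[_ Va] /spec_leP ab.
by exists i => //; rewrite eV; split=> //; exact: ab Va.
Qed.

Let US_closed s : rel_closed W (US s).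
Proof.
apply: rel_closed_down => [|a b Wa [i si]]; first exact: US_sub.
case: (cY i) => D cD eD; rewrite eD => -[_ Db] /spec_leP ab.
exists i => //; rewrite eD; split=> //; apply: contrapT => nDa.
by apply: (ab (~` D) _ nDa) => //; exact: closed_openC.
Qed.

Let st_split_seq s (V : LC X) (oV : rel_open W V) (cV : rel_closed W V)
    (m : M W j) : uniq s -> V = US s :> set X ->
  \sum_(i <- s) st_i M j (oY i) (st_r M j (cY i) m) =
  st_i M j oV (st_r M j cV m).
Proof.
elim: s V oV cV => [|k s IH] V oV cV /=.
  move=> _ V0; rewrite big_nil (@st_set0 M j V (st_r M j cV m)) ?raddf0 //.
  by rewrite V0 -subset0 => x [].
move=> /andP[ks us] VE; rewrite big_cons.
pose V' := MkLC (rel_open_lc (lc_setP W) (US_open s)).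
rewrite (IH V' (US_open s) (US_closed s)) //.
have VkV' : V = Y k `|` V' :> set X.
  rewrite VE; apply/seteqP; split=> x.
    by move=> [i]; rewrite inE => /predU1P[-> |si Yx]; [left|right; exists i].
  by case=> [Yx|[i si Yx]]; [exists k|exists i]; rewrite // inE ?eqxx ?si ?orbT.
have sub (U : set X) : rel_open W U -> U `<=` V -> rel_open V U.
  move=> [T oT ->] UV; exists T => //; apply/seteqP; split=> x [].
    by move=> Wx Tx; split=> //; exact: UV.
  by move=> Vx Tx; split=> //; case: oV Vx => ? _ -> [].
have subc (U : set X) : rel_closed W U -> U `<=` V -> rel_closed V U.
  move=> [T oT ->] UV; exists T => //; apply/seteqP; split=> x [].
    by move=> Wx Tx; split=> //; exact: UV.
  by move=> Vx Tx; split=> //; case: oV Vx => ? _ -> [].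
have kV : Y k `<=` V by rewrite VkV'; left.
have V'V : V' `<=` V by rewrite VkV'; right.
have ok := sub _ (oY k) kV; have ck := subc _ (cY k) kV.
have o' := sub _ (US_open s) V'V; have c' := subc _ (US_closed s) V'V.
have d : topologically_disjoint (Y k) V'.
  split; rewrite -?VkV' // -subset0 => x [Yk [i si Yi]].
  have ki : k != i by apply: contraNneq ks => ->.
  by rewrite -(disjY ki); split.
rewrite -(st_disjoint d VkV' ok ck (o' : rel_open V V') c' (st_r M j cV m)).
rewrite raddfD /=.
rewrite (st_ii _ _ (oY k)) (st_rr _ _ (cY k)).
by rewrite (st_ii _ _ (US_open s : rel_open W V')) (st_rr _ _ (US_closed s : rel_closed W V')).
Qed.

Lemma st_split (m : M W j) : (forall x, (W : set X) x -> exists i, (Y i : set X) x) ->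
  \sum_i st_i M j (oY i) (st_r M j (cY i) m) = m.
Proof.
move=> WY.
have o : rel_open W W by exists setT; [exact: openT|rewrite setIT].
have c : rel_closed W W by exists setT; [exact: closedT|rewrite setIT].
rewrite -[RHS](st_r_id c) -[RHS](st_i_id o); apply: st_split_seq.
  exact: index_enum_uniq.
apply/seteqP; split=> [x /WY[i Yx]|]; last exact: US_sub.
by exists i => //; exact: mem_index_enum.
Qed.

End Split.

Hypotheses (T0 : kolmogorov_space X) (UP : unique_path_space X).

Lemma arrow_boundary_pair x y : arrow x y -> boundary_pair (up x) (cl y).
Proof. exact: arrow_boundary_pair_sets. Qed.

Section Relation.
Variable x : X.

Let cl' : set X := closure [set x] `\ x.
Let up' : set X := open_hull [set x] `\ x.

Let cl'P z : cl' z <-> spec_lt z x.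
Proof. by split=> -[/in_closure1 zx nzx]; split=> //; exact/in_closure1. Qed.

Let up'P z : up' z <-> spec_lt x z.
Proof.
split=> -[] => [/in_open_hull1 xz nzx|xz nzx]; split=> //.
- by move=> /esym.
- exact/in_open_hull1.
- by move=> /esym.
Qed.

Let cl'_closed : closed cl'.
Proof.
apply: closed_down => a b ab /cl'P[bx nbx]; apply/cl'P; split.
  exact: spec_le_trans bx.
by move=> ax; apply: nbx; apply: spec_le_anti => //; rewrite -ax.
Qed.

Let up'_open : open up'.
Proof.
apply: open_up => a b ab /up'P[xa nxa]; apply/up'P; split.
  exact: spec_le_trans ab.
by move=> xb; apply: nxa; apply: spec_le_anti => //; rewrite xb.
Qed.

Let A : LC X.
Proof.
apply: (@MkLC X cl'); exists setT, cl'.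
by split; [exact: openT|exact: cl'_closed|rewrite setTI].
Defined.

Let B : LC X.
Proof.
apply: (@MkLC X up'); exists up', setT.
by split; [exact: up'_open|exact: closedT|rewrite setIT].
Defined.

Let S : LC X := MkLC (star_lc T0 UP x).

Let xup : open_hull [set x] x. Proof. exact/in_open_hull1. Qed.
Let xcl : closure [set x] x. Proof. exact/in_closure1. Qed.

Let upA : open_hull [set x] `|` cl' = S :> set X.
Proof.
apply/seteqP; split=> z [|zx]; [by left|by case: zx; right|by left|].
by have [->|zx'] := pselect (z = x); [left|right].
Qed.

Let Bcl : up' `|` closure [set x] = S :> set X.
Proof.
apply/seteqP; split=> z [zx|]; [by case: zx; left|by right| |by right].
by have [->|zx'] := pselect (z = x); [right|left].
Qed.

Let upcl z : open_hull [set x] z -> closure [set x] z -> z = x.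
Proof. by move=> /in_open_hull1 xz /in_closure1 zx; exact: spec_le_anti. Qed.

Let bA : boundary_pair (up x) A.
Proof.
apply: boundary_pair_open; first exact: open_hull1_open.
  by rewrite -subset0 => z [xz [zx]]; apply; exact: upcl.
by rewrite /= upA; exact: star_lc.
Qed.

Let bB : boundary_pair B (cl x).
Proof.
apply: boundary_pair_open; first exact: up'_open.
  by rewrite -subset0 => z [[xz nz] zx]; apply: nz; exact: upcl.
by rewrite /= Bcl; exact: star_lc.
Qed.

Let oB : rel_open (up x) B.
Proof. by apply: rel_open_open; [exact: up'_open|exact: subDsetl]. Qed.

Let cA : rel_closed (cl x) A.
Proof. by apply: rel_closed_closed; [exact: cl'_closed|exact: subDsetl]. Qed.

Lemma st_center (M : st_module X) j (m : M (cl x) j) :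
  st_i M (~~ j) oB (st_d M j bB m) = st_d M j bA (st_r M j cA m).
Proof.
have clS : cl x `|` S = S :> set X by rewrite setUC -setUA setUid.
have upS : up x `|` S = S :> set X by rewrite setUA setUid.
apply: (@st_di _ M (cl x) (up x) S).
- rewrite setDUl setDv setU0; apply/seteqP; split=> z [xz nz]; split=> //.
    by move=> /(upcl xz).
  by move=> zx; apply: nz; rewrite zx.
- rewrite setDUl setDv set0U; apply/seteqP; split=> z [zx nz]; split=> //.
    by move=> /upcl/(_ zx).
  by move=> xz; apply: nz; rewrite xz.
- by rewrite clS; exact: lc_setP.
- by rewrite clS; apply: rel_closed_closed; [exact: closed_closure|right].
- by rewrite clS; exists setT; [exact: closedT|rewrite setIT].
- by rewrite upS; exact: lc_setP.
- by rewrite upS; apply: rel_open_open; [exact: open_hull1_open|left].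
- by rewrite upS; exists setT; [exact: openT|rewrite setIT].
- by rewrite setUC.
Qed.

Let ocl y (h : arrow x y) : rel_open A (cl y).
Proof.
apply: rel_open_up => [z /in_closure1 zy|a b /cl'P bx /in_closure1 ay ab].
  apply/cl'P; split; first exact: spec_le_trans (arrow_le h).
  have [yx] := arrow_lt h; apply: contra_not => zx.
  by apply: spec_le_anti => //; rewrite -zx.
have [y' xy' by'] := arrow_above T0 bx.
apply/in_closure1; rewrite (arrow_above_inj T0 UP h xy' ay) //.
exact: spec_le_trans by'.
Qed.

Let ccl y (h : arrow x y) : rel_closed A (cl y).
Proof.
apply: rel_closed_closed; first exact: closed_closure.
by case: (ocl h) => V _ -> z [].
Qed.

Let cup z (h : arrow z x) : rel_closed B (up z).
Proof.
apply: rel_closed_down => [w /in_open_hull1 zw|a b /up'P xa /in_open_hull1 zb ab].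
  apply/up'P; split; first exact: spec_le_trans (arrow_le h) zw.
  have [xz] := arrow_lt h; apply: contra_not => xw.
  by apply: spec_le_anti => //; rewrite xw.
have [z' z'x z'a] := arrow_below T0 xa.
apply/in_open_hull1; rewrite (arrow_below_inj T0 UP h z'x zb) //.
exact: spec_le_trans ab.
Qed.

Let oup z (h : arrow z x) : rel_open B (up z).
Proof.
apply: rel_open_open; first exact: open_hull1_open.
by case: (cup h) => V _ -> w [].
Qed.

Lemma st_b_rel (M : st_module X) (n : M (cl x) true) :
  \sum_(y : {y | arrow x y})
     st_d M true (arrow_boundary_pair (valP y))
       (st_r M true (arrow_rel_closed (valP y)) n) =
  \sum_(z : {z | arrow z x})
     st_i M false (arrow_rel_open (valP z))
       (st_d M true (arrow_boundary_pair (valP z)) n).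
Proof.
have disjA (y y' : {y | arrow x y}) : y != y' ->
    cl (val y) `&` cl (val y') = set0.
  move=> /eqP ne; rewrite -subset0 => z [/in_closure1 zy /in_closure1 zy'].
  by apply/ne/val_inj; exact: arrow_above_inj (valP y) (valP y') zy zy'.
have disjB (y y' : {y | arrow y x}) : y != y' ->
    up (val y) `&` up (val y') = set0.
  move=> /eqP ne; rewrite -subset0 => z [/in_open_hull1 zy /in_open_hull1 zy'].
  by apply/ne/val_inj; exact: arrow_below_inj (valP y) (valP y') zy zy'.
have sA := @st_split M true {y | arrow x y} A
  (fun y : {y | arrow x y} => cl (val y)) disjA
  (fun y : {y | arrow x y} => ocl (valP y))
  (fun y : {y | arrow x y} => ccl (valP y)).
have sB := @st_split M (~~ true) {z | arrow z x} B
  (fun z : {z | arrow z x} => up (val z)) disjB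
  (fun z : {z | arrow z x} => oup (valP z))
  (fun z : {z | arrow z x} => cup (valP z)).
transitivity (st_d M true bA (st_r M true cA n)).
  rewrite -[in RHS](sA (st_r M true cA n)); last first.
    move=> z /cl'P/(arrow_above T0)[y xy zy].
    by exists (exist _ y xy); exact/in_closure1.
  rewrite raddf_sum; apply: eq_bigr => y _.
  by rewrite (st_id _ _ (arrow_boundary_pair (valP y)))
             (st_rr _ _ (arrow_rel_closed (valP y))).
rewrite -st_center -[in LHS](sB (st_d M true bB n)); last first.
  move=> z /up'P/(arrow_below T0)[y xy zy].
  by exists (exist _ y xy); exact/in_open_hull1.
rewrite raddf_sum; apply: eq_bigr => z _.
by rewrite (st_ii _ _ (arrow_rel_open (valP z)))
           (st_dr _ _ (arrow_boundary_pair (valP z))).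
Qed.

End Relation.

Definition FB_obj (M : st_module X) : b_module X :=
  @BModule X (fun x => M (cl x) true) (fun x => M (up x) false)
    (fun x y h => st_r M true (arrow_rel_closed h))
    (fun x y h => st_d M true (arrow_boundary_pair h))
    (fun x y h => st_i M false (arrow_rel_open h))
    (fun x n => st_b_rel n).

Definition FB_hom (M N : st_module X) (f : st_hom M N) :
    b_hom (FB_obj M) (FB_obj N) :=
  @BHom X (FB_obj M) (FB_obj N)
    (fun x => f (cl x) true) (fun x => f (up x) false)
    (fun x y h m => st_fun_r f (arrow_rel_closed h) m)
    (fun x y h m => st_fun_d f (arrow_boundary_pair h) m)
    (fun x y h m => st_fun_i f (arrow_rel_open h) m).

Program Definition FB : functor (ModST X) (ModB X) :=
  @Functor (ModST X) (ModB X) FB_obj FB_hom _ _.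
Next Obligation. by move=> M; exact: b_hom_eq. Qed.
Next Obligation. by move=> M N P f g; exact: b_hom_eq. Qed.

End FunctorB.

(* Main.v *)
From HB Require Import structures.
From mathcomp Require Import all_boot all_algebra.
From mathcomp Require Import boolp classical_sets topology.
Require Import Defs.

(** For an exact real-rank-zero-like module M the six-term sequences break into
    0 -> M(U,1) -> M(Y,1) -> M(C,1) -> M(U,0) -> M(Y,0) -> M(C,0) -> 0, so that
    M(-,1) behaves like a sheaf on closed sets and M(-,0) like a cosheaf on open
    sets.  This dictates the inverse functor: G(N)(Y,1) consists of the
    compatible families (m_x) of elements m_x of N(cl x) that vanish off Y,
    G(N)(Y,0) is the quotient of the families (n_x) of elements n_x of N(up x)
    by the relations [n]_x = [i n]_y for x -> y, y in Y, and [n]_x = 0 off Y;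
    the boundary map sends (m_y) to the sum of the [delta m_y]_x over all arrows
    x -> y.  The defining relation of N is what relation (8) requires, and an
    induction on points from below shows that G(N) is exact if N is.

    A module M is compared with G(F(M)) by [beta] : M(Y,1) -> G(F(M))(Y,1) and
    [alpha] : G(F(M))(Y,0) -> M(Y,0).  Both commute with i and r.  The
    difference of the boundary map of M and the one transported along [alpha]
    and [beta] satisfies (6), (7) and (8) and vanishes on the pairs (up x, cl y)
    with x -> y; a reduction to elementary boundary pairs, where the EBP
    hypothesis enters, shows that it vanishes on all boundary pairs.  A five
    lemma argument by induction on the size of Y then shows that [alpha] and
    [beta] are bijective. *)

Set Implicit Arguments.
Unset Strict Implicit.
Unset Printing Implicit Defensive.

Import GRing.Theory.
Local Open Scope classical_set_scope.
Local Open Scope quotient_scope.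
Local Open Scope ring_scope.

(** * Subgroups and quotients *)

Record subgroup (V : zmodType) := Subgroup {
  sg_set :> set V;
  sg0 : sg_set 0;
  sgB : forall u v, sg_set u -> sg_set v -> sg_set (u - v)
}.

Section Subgroups.
Variable V : zmodType.

(** Boolean membership by classical reflection; the library forms subgroups and quotients from
    closed boolean predicates. *)
Definition sg_mem (S : subgroup V) : {pred V} := fun v => `[< sg_set S v >].

Fact sg_mem_closed (S : subgroup V) : zmod_closed (sg_mem S).
Proof.
split=> [|u v]; rewrite !unfold_in; first exact/asboolP/sg0.
by move=> /asboolP Su /asboolP Sv; exact/asboolP/sgB.
Qed.

HB.instance Definition _ (S : subgroup V) :=
  GRing.isZmodClosed.Build V (sg_mem S) (sg_mem_closed S).

Definition sub_of (S : subgroup V) := {v | v \in sg_mem S}.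
HB.instance Definition _ S := SubChoice.on (sub_of S).
HB.instance Definition _ S :=
  [SubChoice_isSubZmodule of sub_of S by <:].

Definition quot_of (S : subgroup V) : zmodType := Quotient.quot (sg_mem S).

Lemma sub_ofP S (u : sub_of S) : sg_set S (val u).
Proof. by case: u => v /=; rewrite unfold_in => /asboolP. Qed.

Definition to_sub S v (h : sg_set S v) : sub_of S :=
  exist _ v (asboolT h : v \in sg_mem S).

Definition to_quot S : V -> quot_of S := \pi_(Quotient.quot (sg_mem S)).

Lemma to_quotD S u v : to_quot S (u + v) = to_quot S u + to_quot S v.
Proof. exact: raddfD. Qed.

HB.instance Definition _ S :=
  GRing.isSemiAdditive.Build V (quot_of S) (to_quot S)
    (conj (raddf0 _) (@to_quotD S)).

Lemma to_quot_eq0 S v : to_quot S v = 0 <-> sg_set S v.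
Proof.
rewrite -[v in _ <-> sg_set _ v]subr0; split=> [v0|Sv].
  apply/asboolP; have := Quotient.idealrBE (sg_mem S) v 0.
  rewrite unfold_in => ->; apply/eqP.
  by rewrite -/(to_quot S v) v0 [RHS](raddf0 (to_quot S)).
rewrite -(raddf0 (to_quot S)); apply/eqP.
by rewrite -Quotient.idealrBE unfold_in; exact/asboolP.
Qed.

Lemma quot_ind S (P : quot_of S -> Prop) :
  (forall v, P (to_quot S v)) -> forall q, P q.
Proof. by move=> Pv q; rewrite -[q]reprK; exact: Pv. Qed.

End Subgroups.

Section SubgroupMaps.
Variables V W : zmodType.

Section SubMap.
Variables (S : subgroup V) (T : subgroup W) (f : {additive V -> W}).
Hypothesis fST : forall v, sg_set S v -> sg_set T (f v).

Definition sub_map (u : sub_of S) : sub_of T := to_sub (fST (sub_ofP u)).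

Fact sub_map_is_additive : zmod_morphism sub_map.
Proof. by move=> u v; apply: val_inj; rewrite /= raddfB. Qed.

HB.instance Definition _ :=
  GRing.isZmodMorphism.Build _ _ sub_map sub_map_is_additive.
End SubMap.

Section QuotLift.
Variables (S : subgroup V) (f : {additive V -> W}).

(** The value is read off at the chosen representative; the vanishing proof is an argument so that
    the additive structure below can be inferred from the term. *)
Definition quot_lift of (forall v, sg_set S v -> f v = 0) :=
  fun q : quot_of S => f (repr q).

Hypothesis fS : forall v, sg_set S v -> f v = 0.

Lemma quot_liftE v : quot_lift fS (to_quot S v) = f v.
Proof.
apply/eqP; rewrite -subr_eq0 -raddfB; apply/eqP/fS/(@to_quot_eq0 V S).
by rewrite raddfB /= /to_quot reprK subrr.
Qed.

Fact quot_lift_is_additive : zmod_morphism (quot_lift fS).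
Proof.
elim/quot_ind => u; elim/quot_ind => v.
by rewrite -raddfB !quot_liftE raddfB.
Qed.

HB.instance Definition _ :=
  GRing.isZmodMorphism.Build _ _ (quot_lift fS) quot_lift_is_additive.
End QuotLift.
End SubgroupMaps.

Section QuotMap.
Variables (V W : zmodType) (S : subgroup V) (T : subgroup W).
Variable f : {additive V -> W}.
Hypothesis fST : forall v, sg_set S v -> sg_set T (f v).

Fact quot_map_subproof v : sg_set S v -> (to_quot T \o f) v = 0.
Proof. by move=> /fST/to_quot_eq0. Qed.

Definition quot_map : {additive quot_of S -> quot_of T} :=
  quot_lift quot_map_subproof.

Lemma quot_mapE v : quot_map (to_quot S v) = to_quot T (f v).
Proof. exact: quot_liftE. Qed.
End QuotMap.

(** * Families indexed by the points of X *)

Section Families.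
Variables (X : finTopologicalType) (T : X -> zmodType).

Definition fam := forall x, T x.

HB.instance Definition _ := gen_eqMixin fam.
HB.instance Definition _ := gen_choiceMixin fam.

Lemma fam_ext (u v : fam) : (forall x, u x = v x) -> u = v.
Proof. exact: functional_extensionality_dep. Qed.

Let add (u v : fam) : fam := fun x => u x + v x.

Fact fam_addA : associative add.
Proof. by move=> u v w; apply: fam_ext => x; exact: addrA. Qed.

Fact fam_addC : commutative add.
Proof. by move=> u v; apply: fam_ext => x; exact: addrC. Qed.

Fact fam_add0 : left_id ((fun=> 0) : fam) add.
Proof. by move=> u; apply: fam_ext => x; exact: add0r. Qed.

Fact fam_addN : left_inverse ((fun=> 0) : fam) (fun u x => - u x) add.
Proof. by move=> u; apply: fam_ext => x; exact: addNr. Qed.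

HB.instance Definition _ := GRing.isZmodule.Build fam
  fam_addA fam_addC fam_add0 fam_addN.

Lemma famD (u v : fam) x : (u + v) x = u x + v x. Proof. by []. Qed.
Lemma famB (u v : fam) x : (u - v) x = u x - v x. Proof. by []. Qed.
Lemma famN (u : fam) x : (- u) x = - u x. Proof. by []. Qed.
Lemma fam0 x : (0 : fam) x = 0. Proof. by []. Qed.

(** Since families are indexed by all of X, cutting off outside U stays in the same group. This one
    operation gives the maps r in degree 1 and the maps i in degree 0 of the inverse functor. *)
Definition restrict (U : set X) (v : fam) : fam :=
  fun x => if `[< U x >] then v x else 0.

Lemma restrict_in U v x : U x -> restrict U v x = v x.
Proof. by rewrite /restrict => /asboolT ->. Qed.

Lemma restrict_out U v x : ~ U x -> restrict U v x = 0.
Proof. by rewrite /restrict => /asboolF ->. Qed.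

Fact restrict_is_additive U : zmod_morphism (restrict U).
Proof.
move=> u v; apply: fam_ext => x; rewrite !famB /restrict.
by case: ifP; rewrite ?subr0.
Qed.

HB.instance Definition _ U :=
  GRing.isZmodMorphism.Build _ _ (restrict U) (restrict_is_additive U).
End Families.

(** * The ST-module of a B-module *)

Section RelativelyOpen.
Variable X : finTopologicalType.
Implicit Types (x y : X) (Y U C : set X).

Lemma rel_open_sub Y U x : rel_open Y U -> U x -> Y x.
Proof. by move=> [V _ ->] []. Qed.

Lemma rel_closed_sub Y C x : rel_closed Y C -> C x -> Y x.
Proof. by move=> [V _ ->] []. Qed.

Lemma rel_open_le Y U x y : rel_open Y U -> U x -> Y y -> spec_le x y -> U y.
Proof.
by move=> [V oV ->] [_ Vx] Yy /spec_leP xy; split=> //; exact: xy Vx.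
Qed.

Lemma rel_closed_le Y C x y :
  rel_closed Y C -> C y -> Y x -> spec_le x y -> C x.
Proof.
move=> [D cD ->] [_ Dy] Yx /spec_leP xy; split=> //.
apply: contrapT => nDx; apply: (xy (~` D) _ nDx) => //.
exact: closed_openC.
Qed.

Lemma arrow_neq x y : arrow x y -> y <> x.
Proof. by case/arrow_lt. Qed.

Lemma boundary_pair_disj U C x : boundary_pair U C -> U x -> C x -> False.
Proof. by case=> Y [_ _ _ ->] []. Qed.

Lemma boundary_pair_lc U C : boundary_pair U C -> locally_closed (U `|` C).
Proof.
case=> Y [lcY CY _ ->]; suff -> : Y `\` C `|` C = Y by [].
by rewrite setUC setDUK.
Qed.

Lemma boundary_pair_le U C x y : boundary_pair U C -> U x -> C y ->
  ~ spec_le x y.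
Proof.
move=> [Y [_ CY oU UE]] Ux Cy xy.
have := rel_open_le oU Ux (CY _ Cy) xy.
by rewrite UE => -[].
Qed.

Lemma rel_open_refl Y : rel_open Y Y.
Proof. by exists setT; [exact: openT|rewrite setIT]. Qed.

Lemma rel_closed_refl Y : rel_closed Y Y.
Proof. by exists setT; [exact: closedT|rewrite setIT]. Qed.

End RelativelyOpen.

Section FromBModule.
Variables (X : finTopologicalType) (N : b_module X).
Implicit Types (Y U C : set X).

(* M(Y,1) is the kernel of M(D,1) -> M(D \ Y,1), where D is the closure of Y;
   indexing the families by all of X makes this independent of D. *)
Definition sections_pred Y : set (fam (b1 N)) := [set m |
  (forall x, ~ Y x -> m x = 0) /\
  (forall x y (h : arrow x y), Y x -> b_r N h (m x) = m y)].

Fact sections0 Y : sections_pred Y 0.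
Proof. by split=> // x y h _; rewrite !fam0 raddf0. Qed.

Fact sectionsB Y u v : sections_pred Y u -> sections_pred Y v -> sections_pred
  Y (u - v).
Proof.
move=> [u0 ur] [v0 vr]; split=> [x Yx|x y h Yx]; rewrite !famB.
  by rewrite u0 // v0 // subrr.
by rewrite raddfB /= ur // vr.
Qed.

Definition sections Y := Subgroup (sections0 Y) (@sectionsB Y).

Definition arrow_family := forall x y, arrow x y -> b0 N x.

(* The sum over all arrows h : x -> y of [n]_x - [i n]_y with n = a x y h. *)
Definition bd (a : arrow_family) : fam (b0 N) := fun w =>
  \sum_(y : {y | arrow w y}) a w (val y) (valP y) -
  \sum_(z : {z | arrow z w}) b_i N (valP z) (a (val z) w (valP z)).

(** Off Y the family is unconstrained, so classes supported there become zero. An arrow into Y that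
    starts outside Y therefore kills the image of [b_i] at its end. *)
Definition relators_pred Y : set (fam (b0 N)) := [set v |
  exists2 a : arrow_family, (forall x y (h : arrow x y), ~ Y y -> a x y h = 0) &
    forall w, Y w -> v w = bd a w].

Lemma bd0 w : bd (fun _ _ _ => 0) w = 0.
Proof. by rewrite /bd !big1 ?subr0 // => i _; rewrite ?raddf0. Qed.

Lemma bdB (a b : arrow_family) w :
  bd (fun x y h => a x y h - b x y h) w = bd a w - bd b w.
Proof.
rewrite /bd sumrB opprD opprK addrACA; congr (_ + _).
by under eq_bigr do rewrite raddfB; rewrite sumrB opprB addrC.
Qed.

Fact relators0 Y : relators_pred Y 0.
Proof. by exists (fun _ _ _ => 0) => // w _; rewrite bd0. Qed.

Fact relatorsB Y u v : relators_pred Y u -> relators_pred Y v -> relators_pred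
  Y (u - v).
Proof.
move=> [a a0 ua] [b b0 vb]; exists (fun x y h => a x y h - b x y h).
  by move=> x y h nYy; rewrite a0 // b0 // subrr.
by move=> w Yw; rewrite bdB famB ua // vb.
Qed.

Definition relators Y := Subgroup (relators0 Y) (@relatorsB Y).

Lemma to_quot_ext Y u v : (forall w, Y w -> u w = v w) ->
  to_quot (relators Y) u = to_quot (relators Y) v.
Proof.
move=> uv; apply/eqP; rewrite -subr_eq0 -raddfB; apply/eqP/to_quot_eq0.
by exists (fun _ _ _ => 0) => // w Yw; rewrite bd0 famB uv // subrr.
Qed.

(** Extension by zero stays compatible because U is upward closed in Y: an arrow that starts in Y \
    U cannot end in U. *)
Lemma sections_open Y U : rel_open Y U -> forall m, sections_pred U m ->
  sections_pred Y m.
Proof.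
move=> oU m [m0 mr]; split=> [x nYx|x y h Yx].
  by apply: m0 => /(rel_open_sub oU).
have [Ux|nUx] := pselect (U x); first exact: mr.
rewrite m0 // raddf0 m0 // => Uy; apply: nUx.
exact: rel_open_le oU Uy Yx (arrow_le h).
Qed.

(** An arrow from C either ends in C, as C is downward closed in Y, or leaves Y, where m is zero. *)
Lemma sections_restrict Y C : rel_closed Y C ->
  forall m, sections_pred Y m -> sections_pred C (restrict C m).
Proof.
move=> cC m [m0 mr]; split=> [x|x y h Cx]; first exact: restrict_out.
rewrite restrict_in // mr; last exact: rel_closed_sub Cx.
have [Cy|nCy] := pselect (C y); first by rewrite restrict_in.
rewrite restrict_out // m0 // => Yy; apply: nCy.
exact: rel_closed_le cC Cx Yy (arrow_le h).
Qed.

(** The same [a] serves: at a point of Y \ U both sums of [bd a] vanish, since arrows leaving it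
    cannot end in U and [a] is zero on arrows ending off U. *)
Lemma relators_open Y U : rel_open Y U ->
  forall v, relators_pred U v -> relators_pred Y (restrict U v).
Proof.
move=> oU v [a a0 va]; exists a => [x y h nYy|w Yw].
  by apply: a0 => /(rel_open_sub oU).
have [Uw|nUw] := pselect (U w); first by rewrite restrict_in ?va.
rewrite restrict_out // /bd !big1 ?subr0 // => -[y h] _ /=.
  by rewrite a0 ?raddf0.
rewrite a0 // => Uy; apply: nUw; exact: rel_open_le oU Uy Yw (arrow_le h).
Qed.

(** Only the arrows ending in C are kept. An arrow from C to a point of Y ends in C, so [bd] does
    not change at points of C. *)
Lemma relators_closed Y C : rel_closed Y C -> forall v, relators_pred Y v ->
  relators_pred C v.
Proof.
move=> cC v [a a0 va].
exists (fun x y h => if `[< C y >] then a x y h else 0).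
  by move=> x y h /asboolF ->.
move=> w Cw; rewrite va; last exact: rel_closed_sub Cw.
rewrite /bd; congr (_ - _); apply: eq_bigr => -[y h] _ /=;
  last by rewrite asboolT.
case: ifP => // /asboolP nCy; rewrite a0 // => Yy; apply: nCy.
exact: rel_closed_le cC Cw Yy (arrow_le h).
Qed.

Definition dl (m : fam (b1 N)) : fam (b0 N) := fun w =>
  \sum_(y : {y | arrow w y}) b_d N (valP y) (m (val y)).

Fact dl_is_additive : zmod_morphism dl.
Proof.
move=> u v; apply: fam_ext => w; rewrite famB -sumrB.
by apply: eq_bigr => y _; rewrite famB raddfB.
Qed.

HB.instance Definition _ :=
  GRing.isZmodMorphism.Build _ _ dl dl_is_additive.

Definition gb_obj (Y : LC X) (j : bool) : zmodType :=
  if j then (sub_of (sections Y) : zmodType) else quot_of (relators Y).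

Definition gb_i (U Y : LC X) j :
    rel_open Y U -> {additive gb_obj U j -> gb_obj Y j} :=
  match j return rel_open Y U -> {additive gb_obj U j -> gb_obj Y j} with
  | true => fun h => @sub_map _ _ (sections U) (sections Y) idfun
    (sections_open h)
  | false => fun h =>
    @quot_map _ _ (relators U) (relators Y) (restrict U) (relators_open h)
  end.

Definition gb_r (Y C : LC X) j :
    rel_closed Y C -> {additive gb_obj Y j -> gb_obj C j} :=
  match j return rel_closed Y C -> {additive gb_obj Y j -> gb_obj C j} with
  | true => fun h => @sub_map _ _ (sections Y) (sections C) (restrict C)
    (sections_restrict h)
  | false => fun h => @quot_map _ _ (relators Y) (relators C) idfun
    (relators_closed h)
  end.

Definition gb_d (C U : LC X) j :
    boundary_pair U C -> {additive gb_obj C j -> gb_obj U (~~ j)} :=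
  match j return boundary_pair U C -> {additive gb_obj C j -> gb_obj U (~~ j)}
  with
  | true => fun=> to_quot (relators U) \o dl \o val
  | false => fun=> \0
  end.

Lemma gb_iE (U Y : LC X) (h : rel_open Y U) (v : fam (b0 N)) :
  gb_i false h (to_quot (relators U) v) = to_quot (relators Y) (restrict U v).
Proof. exact: quot_mapE. Qed.

Lemma gb_rE (Y C : LC X) (h : rel_closed Y C) (v : fam (b0 N)) :
  gb_r false h (to_quot (relators Y) v) = to_quot (relators C) v.
Proof. exact: quot_mapE. Qed.

Lemma gb_i_id (Y : LC X) j (h : rel_open Y Y) (m : gb_obj Y j) :
  gb_i j h m = m.
Proof.
case: j m => [m|]; first exact: val_inj.
elim/quot_ind => v; rewrite gb_iE; apply: to_quot_ext => w Yw.
exact: restrict_in.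
Qed.

Lemma section_out (Y : LC X) (m : gb_obj Y true) x :
  ~ (Y : set X) x -> val m x = 0.
Proof. by have [m0 _] := sub_ofP m; exact: m0. Qed.

Lemma section_r (Y : LC X) (m : gb_obj Y true) x y (h : arrow x y) :
  (Y : set X) x -> b_r N h (val m x) = val m y.
Proof. by have [_ mr] := sub_ofP m; exact: mr. Qed.

Lemma section_restrict (Y : LC X) (m : gb_obj Y true) (C : set X) :
  Y `<=` C -> restrict C (val m) = val m.
Proof.
move=> YC; apply: fam_ext => x; have [Cx|nCx] := pselect (C x).
  exact: restrict_in.
by rewrite restrict_out // section_out // => /YC.
Qed.

Lemma gb_r_id (Y : LC X) j (h : rel_closed Y Y) (m : gb_obj Y j) :
  gb_r j h m = m.
Proof.
case: j m => [m|]; first by apply: val_inj; rewrite /= section_restrict.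
by elim/quot_ind => v; rewrite gb_rE.
Qed.

Lemma gb_disjoint (Y Z W : LC X) j :
    topologically_disjoint Y Z -> W = Y `|` Z :> set X ->
    forall (oY : rel_open W Y) (cY : rel_closed W Y)
      (oZ : rel_open W Z) (cZ : rel_closed W Z) (m : gb_obj W j),
    gb_i j oY (gb_r j cY m) + gb_i j oZ (gb_r j cZ m) = m.
Proof.
move=> [YZ _ _] WE oY cY oZ cZ.
have disj x : (Y : set X) x -> ~ (Z : set X) x.
  by move=> Yx Zx; rewrite -[False]/(set0 x) -YZ.
have key (T : X -> zmodType) (v : fam T) x : (W : set X) x ->
    restrict Y v x + restrict Z v x = v x.
  rewrite WE => -[Yx|Zx].
    by rewrite restrict_in // restrict_out ?addr0 //; exact: disj.
  by rewrite [in X in _ + X]restrict_in // restrict_out ?add0r // => /disj.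
case: j => [m|].
  apply: val_inj; apply: fam_ext => x; rewrite raddfD /= famD.
  have [Wx|nWx] := pselect ((W : set X) x); first exact: key.
  rewrite [RHS]section_out // !restrict_out ?addr0 //.
    by move=> /(rel_open_sub oZ).
  by move=> /(rel_open_sub oY).
elim/quot_ind => v; rewrite !gb_rE !gb_iE -raddfD.
by apply: to_quot_ext => w Ww; rewrite famD key.
Qed.

Lemma gb_ii (U V Y : LC X) j
    (oUV : rel_open V U) (oVY : rel_open Y V) (oUY : rel_open Y U)
    (m : gb_obj U j) :
  gb_i j oVY (gb_i j oUV m) = gb_i j oUY m.
Proof.
case: j m => [m|]; first exact: val_inj.
elim/quot_ind => v; rewrite !gb_iE; apply: to_quot_ext => w Yw.
have [Vw|nVw] := pselect ((V : set X) w); first by rewrite restrict_in.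
by rewrite !restrict_out // => /(rel_open_sub oUV).
Qed.

Lemma gb_rr (Y D C : LC X) j
    (cD : rel_closed Y D) (cC : rel_closed D C) (cYC : rel_closed Y C)
    (m : gb_obj Y j) :
  gb_r j cC (gb_r j cD m) = gb_r j cYC m.
Proof.
case: j m => [m|]; last by elim/quot_ind => v; rewrite !gb_rE.
apply: val_inj; apply: fam_ext => x /=.
have [Cx|nCx] := pselect ((C : set X) x); last by rewrite !restrict_out.
by rewrite !restrict_in //; exact: rel_closed_sub Cx.
Qed.

Lemma gb_ir (Y U C UC : LC X) j : UC = U `&` C :> set X ->
    forall (oU : rel_open Y U) (cC : rel_closed Y C)
      (cUC : rel_closed U UC) (oUC : rel_open C UC) (m : gb_obj U j),
    gb_r j cC (gb_i j oU m) = gb_i j oUC (gb_r j cUC m).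
Proof.
move=> UCE oU cC cUC oUC; case: j => [m|].
  apply: val_inj; apply: fam_ext => x /=.
  have [Cx|nCx] := pselect ((C : set X) x); last first.
    by rewrite !restrict_out // UCE => -[].
  rewrite restrict_in //; have [Ux|nUx] := pselect ((U : set X) x).
    by rewrite restrict_in // UCE.
  by rewrite section_out // restrict_out // UCE => -[].
elim/quot_ind => v; rewrite gb_rE !gb_iE gb_rE; apply: to_quot_ext => w Cw.
have [Uw|nUw] := pselect ((U : set X) w).
  by rewrite !restrict_in // UCE.
by rewrite !restrict_out // UCE => -[].
Qed.

Lemma gb_id (U C C' : LC X) j
    (b : boundary_pair U C) (oC' : rel_open C C') (b' : boundary_pair U C')
    (m : gb_obj C' j) :
  gb_d j b (gb_i j oC' m) = gb_d j b' m.
Proof. by case: j m. Qed.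

Lemma gb_dr (U C U' : LC X) j
    (b : boundary_pair U C) (cU' : rel_closed U U') (b' : boundary_pair U' C)
    (m : gb_obj C j) :
  gb_r (~~ j) cU' (gb_d j b m) = gb_d j b' m.
Proof.
case: j m => m; last by rewrite /= raddf0.
exact: (gb_rE cU' (dl (val m))).
Qed.

Lemma gb_di (Y Z W WY WZ : LC X) j :
    WY = W `\` Y :> set X -> WZ = W `\` Z :> set X ->
    rel_closed (Y `|` W) Y -> rel_closed (Y `|` W) W ->
    rel_open (Z `|` W) Z -> rel_open (Z `|` W) W ->
    W `<=` Y `|` Z ->
    forall (b : boundary_pair WY Y) (o : rel_open Z WY)
      (c : rel_closed Y WZ) (b' : boundary_pair Z WZ) (m : gb_obj Y j),
    gb_i (~~ j) o (gb_d j b m) = gb_d j b' (gb_r j c m).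
Proof.
move=> WYE WZE cYW cW oZW oW WYZ b o c b'; case: j => m;
  last by rewrite /= !raddf0.
rewrite [LHS](gb_iE o (dl (val m))).
apply/eqP; rewrite -subr_eq0 -raddfB; apply/eqP/to_quot_eq0 => /=.
(* The two sides differ by the defining relations of N at the points of T. *)
pose T : set X := W `&` Y `&` Z.
pose a : arrow_family := fun x y h =>
  if `[< T y >] then b_d N h (val m y) else 0.
have WYP x : (WY : set X) x <-> (W : set X) x /\ ~ (Y : set X) x by rewrite WYE.
have WZP x : (WZ : set X) x <-> (W : set X) x /\ ~ (Z : set X) x by rewrite WZE.
exists a => [x y h nZy|w Zw]; first by rewrite /a asboolF // => -[].
have Wup y : arrow w y -> (W : set X) y -> (W : set X) w.
  by move=> /arrow_le yw Wy; apply: (rel_open_le oW Wy) yw; left.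
have Wdown y : arrow w y -> (W : set X) w -> (Y : set X) y -> (W : set X) y.
  by move=> /arrow_le yw Ww Yy; apply: (rel_closed_le cW Ww) yw; left.
have Tm : T w ->
    \sum_(z : {z | arrow z w}) b_i N (valP z) (a (val z) w (valP z)) =
    \sum_(y : {y | arrow w y}) b_d N (valP y) (val m (val y)).
  move=> Tw; rewrite /a asboolT // -b_rel; apply: eq_bigr => y _.
  by rewrite section_r //; case: Tw => -[].
have nTm : ~ T w ->
    \sum_(z : {z | arrow z w}) b_i N (valP z) (a (val z) w (valP z)) = 0.
  by move=> nTw; rewrite /a asboolF // big1 // => z _; rewrite raddf0.
rewrite famB /bd.
(* A point w of Z lies off W, where all terms vanish, or in T, where [Tm] applies, or in WY, where
   arrows ending at w contribute nothing by [nTm]. *)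
have [Ww|nWw] := pselect ((W : set X) w); last first.
  rewrite nTm ?subr0; last by case=> -[].
  rewrite restrict_out ?sub0r; last by move=> /WYP[].
  rewrite /dl !big1 ?oppr0 // => y _.
    by rewrite /a asboolF // => -[[Wy _] _]; exact/nWw/Wup/Wy/valP.
  by rewrite restrict_out ?raddf0 // => /WZP[Wy _]; exact/nWw/Wup/Wy/valP.
have [Yw|nYw] := pselect ((Y : set X) w).
  rewrite Tm // restrict_out ?sub0r; last by move=> /WYP[].
  rewrite /dl -sumrB -sumrN; apply: eq_bigr => -[y h] _ /=.
  have [Yy|nYy] := pselect ((Y : set X) y); last first.
    rewrite /a asboolF; last by case=> -[].
    by rewrite sub0r section_out // restrict_out ?raddf0 // => /(rel_closed_sub
      c).
  have Wy := Wdown y h Ww Yy.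
  have [Zy|nZy] := pselect ((Z : set X) y).
    rewrite /a asboolT // subrr restrict_out ?raddf0 ?oppr0 //.
    by move=> /WZP[].
  rewrite /a asboolF ?sub0r; last by case.
  by rewrite restrict_in //; apply/WZP.
rewrite nTm ?subr0; last by case=> -[].
rewrite restrict_in; last exact/WYP.
rewrite /dl -sumrB; apply: eq_bigr => -[y h] _ /=.
have [Yy|nYy] := pselect ((Y : set X) y); last first.
  rewrite /a asboolF; last by case=> -[].
  by rewrite section_out // restrict_out ?raddf0 ?addr0 // => /(rel_closed_sub
    c).
have Wy := Wdown y h Ww Yy.
have [Zy|nZy] := pselect ((Z : set X) y).
  rewrite /a asboolT // restrict_out ?raddf0 ?addr0 //.
  by move=> /WZP[].
rewrite /a asboolF; last by case.
by rewrite restrict_in ?subrr //; apply/WZP.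
Qed.

Definition GB_obj : st_module X :=
  @STModule X gb_obj gb_i gb_r gb_d gb_i_id gb_r_id gb_disjoint gb_ii gb_rr
    gb_ir gb_id gb_dr
    (fun (Y Z W WY WZ : LC X) j e e' _ cY cW _ => @gb_di Y Z W WY WZ j e e' cY
      cW).

Lemma GB_obj_rrzl : st_real_rank_zero_like GB_obj.
Proof. by []. Qed.

End FromBModule.
Arguments gb_i {X N U Y} j h.
Arguments gb_r {X N Y C} j h.
Arguments gb_d {X N C U} j b.

(** * Exactness *)

Section Extremal.
Variables (X : finTopologicalType) (T0 : kolmogorov_space X).
Implicit Types (S : set X) (x y z : X).

Let height x := #|[pred z | `[< spec_le z x >]]|.

Let height_lt x y : spec_lt x y -> (height x < height y)%N.
Proof.
move=> [xy nxy]; apply: proper_card; apply/properP; split.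
  apply/fintype.subsetP => z; rewrite !inE => zx.
  exact: spec_le_trans xy.
exists y; rewrite inE; first by [].
by apply/asboolP => yx; apply: nxy; exact: spec_le_anti.
Qed.

(** The number of points below a point is strictly monotone, so a point of S where it is smallest is
    minimal in S. *)
Lemma minimal_point S x : S x ->
  exists2 w, S w & forall y, S y -> ~ spec_lt y w.
Proof.
move=> /asboolP Sx; case: (@arg_minnP X x (fun z => `[< S z >]) height Sx) => w.
move=> /asboolP Sw wmin; exists w => // y /asboolP /wmin + yw.
by rewrite leqNgt height_lt.
Qed.

Lemma maximal_point S x : S x ->
  exists2 w, S w & forall y, S y -> ~ spec_lt w y.
Proof.
move=> /asboolP Sx.
have hx z : `[< S z >] -> (height z <= #|X|)%N by move=> _; exact: max_card.
case: (@arg_maxnP X x (fun z => `[< S z >]) height Sx) => w.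
move=> /asboolP Sw wmax; exists w => // y /asboolP /wmax + yw.
by rewrite /= leqNgt height_lt.
Qed.

Definition card_set S := #|[pred z | `[< S z >]]|.

Lemma card_set_lt S S' x : S `<=` S' -> ~ S x -> S' x ->
  (card_set S < card_set S')%N.
Proof.
move=> SS' nSx S'x; apply: proper_card; apply/properP; split.
  apply/fintype.subsetP => z;  by rewrite !inE; exact: SS'.
by exists x; rewrite inE; [|exact/asboolP].
Qed.

End Extremal.

Section GBExact.
Variables (X : finTopologicalType) (T0 : kolmogorov_space X).
Variable N : b_module X.

Section Exact.
Hypothesis exN : b_exact N.

(* The points of S are treated from below; each step is one use of the
   exactness of N. *)
Lemma lift_family (S : set X) (a : arrow_family N) (m0 : fam (b1 N)) :
  (forall x y (h : arrow x y), ~ S y -> a x y h = - b_d N h (m0 y)) ->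
  (forall w, S w -> bd a w = 0) ->
  exists m : fam (b1 N), [/\ forall x, ~ S x -> m x = m0 x,
    forall x y (h : arrow x y), S x -> b_r N h (m x) = m y &
    forall x y (h : arrow x y), a x y h = - b_d N h (m y)].
Proof.
have [n] := ubnP (card_set S); elim: n S m0 => // n IH S m0; rewrite ltnS => Sn.
move=> am0 bda.
have [[x0 Sx0]|S0] := pselect (exists x, S x); last first.
  exists m0; split=> // x y h; first by move=> Sx; case: S0; exists x.
  by apply: am0 => Sy; case: S0; exists y.
have [w Sw wmin] := minimal_point T0 Sx0.
have Sarrow y : arrow w y -> ~ S y by move=> /arrow_lt yw /wmin.
(* Arrows from the minimal point w end outside S, where [am0] gives the values of [a]. Hence
   [bd a w = 0] says, up to sign, that the values of m0 and the incoming values of [a] form an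
   element of the kernel in the sequence of N at w. *)
have [|k [kr kd]] := iffLR (exN (x := w) (fun y => m0 (val y))
    (fun z => a (val z) w (valP z))).
  apply/eqP; rewrite -oppr_eq0 opprD -sumrN -[X in _ == X](bda w Sw) /bd.
  apply/eqP; congr (_ - _); apply: eq_bigr => y _.
  by rewrite am0 //; exact/Sarrow/valP.
(* The lift k replaces the value of m0 at w, and the induction continues with w removed from S. *)
pose m1 : fam (b1 N) := dfwith m0 k.
have m1w : m1 w = k by rewrite /m1 dfwith_in.
have m1x x : x <> w -> m1 x = m0 x.
  by move=> /eqP xw; rewrite /m1 dfwith_out // eq_sym.
have [||x [Sx _]|m [mS mr ma]] := IH (S `\ w) m1.
- by apply: leq_trans Sn; apply: card_set_lt Sw => [x []|[_]] //; apply.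
- move=> x y h; have [ywE|nyw] := pselect (y = w); last first.
    by move=> nSy; rewrite am0 ?m1x // => Sy; apply: nSy.
  move: h; rewrite ywE => h _; rewrite m1w.
  by have := kd (exist _ x h); rewrite [valP _](bool_irrelevance _ h).
- exact: bda.
have mw : m w = k by rewrite mS // => -[_ /(_ erefl)].
have mnS x : ~ S x -> m x = m0 x.
  move=> nSx; rewrite mS; first by rewrite m1x // => xw; apply: nSx; rewrite xw.
  by case.
exists m; split=> // x y h Sx.
have [xwE|nxw] := pselect (x = w); last exact: mr.
move: h; rewrite xwE => h; rewrite mw mnS; last exact: Sarrow.
by have := kr (exist _ y h); rewrite [valP _](bool_irrelevance _ h) => /esym.
Qed.

End Exact.

(** The defining relation of N turns the incoming sum of [bd] into an outgoing one; the difference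
    then measures how far m is from being compatible at w. *)
Lemma bd_dl (m : fam (b1 N)) w :
  bd (fun x y h => b_d N h (m y)) w =
  dl m w - \sum_(y : {y | arrow w y}) b_d N (valP y) (b_r N (valP y) (m w)).
Proof. by rewrite b_rel. Qed.

Lemma to_quot_eq Y (u v : fam (b0 N)) : relators_pred Y (u - v) ->
  to_quot (relators N Y) u = to_quot (relators N Y) v.
Proof.
move=> uv; apply/eqP; rewrite -subr_eq0 -raddfB; apply/eqP.
exact/to_quot_eq0.
Qed.

(** * The six-term sequence of G(N) *)

Section Sequence.
Variables (U Y C : LC X) (o : rel_open Y U) (c : rel_closed Y C).
Hypotheses (b : boundary_pair U C) (CE : C = Y `\` U :> set X).

Let CP x : (C : set X) x <-> (Y : set X) x /\ ~ (U : set X) x.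
Proof. by rewrite CE. Qed.

Lemma gb_ri j (u : gb_obj N U j) : gb_r j c (gb_i j o u) = 0.
Proof.
case: j u => [u|].
  apply: val_inj; apply: fam_ext => x /=; rewrite fam0.
  have [Cx|nCx] := pselect ((C : set X) x); last by rewrite restrict_out.
  by rewrite restrict_in // section_out //; have /CP[] := Cx.
elim/quot_ind => v; rewrite gb_iE gb_rE -(raddf0 (to_quot (relators N C))).
by apply: to_quot_ext => w /CP[_ nUw]; rewrite restrict_out.
Qed.

(** At a point of U the relation of N involves the values of y on C and on U together, so the
    boundary of the part on C is the relator given by the part on U with the opposite sign. *)
Lemma gb_dr0 (y : gb_obj N Y true) : gb_d true b (gb_r true c y) = 0.
Proof.
apply/to_quot_eq0; rewrite /=.
exists (fun x z h => - (if `[< (U : set X) z >] then b_d N h (val y z) else 0)).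
  by move=> x z h nUz; rewrite asboolF // oppr0.
move=> w Uw; rewrite /bd asboolT //.
under [X in _ - X]eq_bigr do rewrite raddfN.
rewrite [X in _ - X]sumrN opprK -b_rel -big_split /=.
apply: eq_bigr => -[z h] _ /=; rewrite section_r; last exact: rel_open_sub Uw.
have [Uz|nUz] := pselect ((U : set X) z).
  by rewrite asboolT // addNr restrict_out ?raddf0 // => /CP[].
rewrite asboolF // oppr0 add0r.
have [Yz|nYz] := pselect ((Y : set X) z).
  by rewrite restrict_in //; apply/CP.
by rewrite restrict_out ?section_out // => /CP[].
Qed.

(** By [bd_dl], the relator with values [b_d N h (val x y)] equals [dl] of x at points of U, where x
    vanishes, and is zero at points of C, where x is compatible. *)
Lemma gb_i_d0 (x : gb_obj N C true) : gb_i false o (gb_d true b x) = 0.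
Proof.
rewrite [LHS](gb_iE o (dl (val x))); apply/to_quot_eq0 => /=.
exists (fun z y h => b_d N h (val x y)).
  move=> z y h nYy; rewrite section_out ?raddf0 // => Cy; apply: nYy.
  exact: rel_closed_sub Cy.
move=> w Yw; rewrite bd_dl.
have [Uw|nUw] := pselect ((U : set X) w).
  rewrite restrict_in // [X in _ - X]big1 ?subr0 // => y _.
  by rewrite section_out ?raddf0 // => /CP[].
rewrite restrict_out // /dl; apply/eqP; rewrite eq_sym subr_eq0; apply/eqP.
by apply: eq_bigr => y _; rewrite section_r //; apply/CP.
Qed.

Lemma gb_i_inj (u : gb_obj N U true) : gb_i true o u = 0 -> u = 0.
Proof. by move=> /(congr1 val) /= u0; exact: val_inj. Qed.

Lemma gb_r_surj (q : gb_obj N C false) : exists y, gb_r false c y = q.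
Proof.
elim/quot_ind: q => v; exists (to_quot (relators N Y) v); exact: gb_rE.
Qed.

Lemma gb_exact_mid1 (m : gb_obj N Y true) :
  gb_r true c m = 0 -> exists u, gb_i true o u = m.
Proof.
move=> /(congr1 val) /= rm0.
have m0 x : ~ (U : set X) x -> val m x = 0.
  move=> nUx; have [Yx|nYx] := pselect ((Y : set X) x); last exact: section_out.
  have Cx : (C : set X) x by apply/CP.
  by rewrite -(restrict_in (val m) Cx) rm0.
have mU : sg_set (sections N U) (val m).
  by split=> // x y h Ux; rewrite section_r //; exact: rel_open_sub Ux.
by exists (to_sub mU); apply: val_inj.
Qed.

(** The relator that equals v on C is also a relator for Y; after subtracting it, the family
    vanishes on C and comes from U. *)
Lemma gb_exact_mid0 (m : gb_obj N Y false) :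
  gb_r false c m = 0 -> exists u, gb_i false o u = m.
Proof.
elim/quot_ind: m => v; rewrite gb_rE => /to_quot_eq0[a a0 va].
exists (to_quot (relators N U) (v - (bd a : fam (b0 N)))); rewrite gb_iE.
apply/esym/to_quot_eq; exists a => [x y h nYy|w Yw].
  by apply: a0 => /(rel_closed_sub c).
rewrite famB; have [Uw|nUw] := pselect ((U : set X) w).
  by rewrite restrict_in // famB subKr.
by rewrite restrict_out // subr0 va //; apply/CP.
Qed.

Hypothesis exN : b_exact N.

Lemma gb_exact_d (m : gb_obj N C true) :
  gb_d true b m = 0 -> exists y, gb_r true c y = m.
Proof.
move=> /to_quot_eq0[a a0 ma].
have U0 x : (U : set X) x -> val m x = 0.
  by move=> Ux; rewrite section_out // => /CP[].
(* On U, [bd a] is the boundary of m, while m itself vanishes there. Subtracting the arrow family of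
   m leaves a family with zero [bd] on U, and [lift_family] extends m over U. *)
have [x y h nUy|w Uw|k [kU kr _]] := @lift_family exN U
    (fun x y h => a x y h - b_d N h (val m y)) (val m).
- by rewrite a0 // sub0r.
- rewrite bdB -ma // bd_dl /=.
  by rewrite U0 // [X in _ - (_ - X)]big1 ?subr0 ?subrr // => y _;
    rewrite !raddf0.
have kY : sg_set (sections N Y) k.
  split=> [x nYx|x y h Yx].
    rewrite kU; last by move=> /(rel_open_sub o).
    by rewrite section_out // => /CP[].
  have [Ux|nUx] := pselect ((U : set X) x); first exact: kr.
  rewrite kU // section_r; last exact/CP.
  rewrite kU // => Uy; apply: nUx.
  exact: rel_open_le o Uy Yx (arrow_le h).
exists (to_sub kY); apply: val_inj; apply: fam_ext => x /=.
have [Cx|nCx] := pselect ((C : set X) x).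
  by rewrite restrict_in // kU //; have /CP[] := Cx.
by rewrite restrict_out // section_out.
Qed.

Lemma gb_exact_i0 (m : gb_obj N U false) :
  gb_i false o m = 0 -> exists x, gb_d true b x = m.
Proof.
elim/quot_ind: m => v; rewrite gb_iE => /to_quot_eq0[a a0 va].
(* Truncated to arrows ending in C, [a] still has the same [bd] on C, which is zero because
   [restrict U v] vanishes there. Starting from the zero family, the lift k is a section supported
   on C. *)
have [x y h nCy|w Cw|k [kC kr ka]] := @lift_family exN C
    (fun x y h => if `[< (C : set X) y >] then a x y h else 0) 0.
- by rewrite asboolF // fam0 raddf0 oppr0.
- have [Yw nUw] := iffLR (CP w) Cw.
  rewrite -[RHS](restrict_out v nUw) va // /bd; congr (_ - _).
    apply: eq_bigr => -[y h] _ /=; case: ifP => // /asboolP nCy.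
    rewrite a0 // => Yy; have Uy : (U : set X) y.
      by apply: contrapT => nUy; apply/nCy/CP.
    apply: nUw; exact: rel_open_le o Uy Yw (arrow_le h).
  by rewrite asboolT.
have kS : sg_set (sections N C) k by split.
(* On arrows ending in C, [a] is minus the boundary family of k, hence the sign; the part of [a] on
   arrows ending in U is the relator that accounts for the rest of v. *)
exists (- to_sub kS); rewrite raddfN /= -raddfN.
apply: to_quot_eq.
exists (fun x y h => - (if `[< (U : set X) y >] then a x y h else 0)).
  by move=> x y h nUy; rewrite asboolF // oppr0.
move=> w Uw; rewrite famB famN -(restrict_in v Uw) va;
  last exact: rel_open_sub Uw.
rewrite /bd asboolT // opprD opprK addrA; congr (_ + _); last first.
  by under [in RHS]eq_bigr do rewrite raddfN; rewrite sumrN opprK.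
rewrite /dl -opprD -big_split -sumrN; apply: eq_bigr => y _ /=.
have := ka w (val y) (valP y); have [Cy|nCy] := pselect ((C : set X) (val y)).
  rewrite asboolT // => ->; rewrite subrr asboolF //.
  by move=> Uy; have /CP[] := Cy.
rewrite kC // raddf0 add0r => _.
case: ifP => // /asboolP nUy; rewrite a0 // => Yy.
by apply: nCy; apply/CP.
Qed.

End Sequence.

Lemma GB_obj_exact : b_exact N -> st_exact (GB_obj N).
Proof.
move=> exN U Y C o c b CE []; split=> m.
- split=> [|[u <-]]; [exact: gb_exact_mid1|exact: (gb_ri o c CE)].
- split=> [|[u <-]]; [exact: gb_exact_d|exact: (gb_dr0 o c b CE)].
- split=> [|[u <-]]; [exact: gb_exact_i0|exact: (gb_i_d0 o c b CE)].
- split=> [|[u <-]]; [exact: gb_exact_mid0|exact: (gb_ri o c CE)].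
(* In degree 0 the boundary map is zero, so exactness asks that r be onto in degree 0 and i
   injective in degree 1. *)
- by split=> // _; exact: gb_r_surj.
- split=> [/gb_i_inj ->|[u <-]]; last by rewrite raddf0.
  by exists 0; rewrite raddf0.
Qed.

End GBExact.

(** * Locally closed sets and their relatively open and closed subsets *)

Section LocallyClosed.
Variable X : finTopologicalType.
Implicit Types (x y : X) (Y Z : set X).

Lemma LC_eq (Y Z : LC X) : Y = Z :> set X -> Y = Z.
Proof.
case: Y Z => [Y lY] [Z lZ] /= YZ; move: lY lZ; rewrite YZ => lY lZ.
by rewrite (Prop_irrelevance lY lZ).
Qed.

(** Converse of [convex_lc]: the open factor is upward closed and the closed factor downward
    closed. *)
Lemma lc_convex Y a b c : locally_closed Y -> Y a -> Y c ->
  spec_le a b -> spec_le b c -> Y b.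
Proof.
move=> [V [D [oV cD ->]]] [Va Da] [Vc Dc] ab bc; split.
  by move/spec_leP: ab; apply.
apply: contrapT => nDb; have nDc : (~` D) c; last exact: nDc Dc.
by move/spec_leP: bc; apply=> //; exact: closed_openC.
Qed.

Lemma lc_setI Y Z : locally_closed Y -> locally_closed Z ->
  locally_closed (Y `&` Z).
Proof.
move=> lY lZ; apply: convex_lc => a b c [Ya Za] [Yc Zc] ab bc.
by split; [exact: lc_convex lY Ya Yc ab bc|exact: lc_convex lZ Za Zc ab bc].
Qed.

Definition lcI (Y Z : LC X) : LC X := MkLC (lc_setI (lc_setP Y) (lc_setP Z)).

Lemma rel_closed_cl (Y : LC X) x : rel_closed Y (lcI Y (cl x)).
Proof. by exists (closure [set x]) => //; exact: closed_closure. Qed.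

Lemma rel_open_up1 (Y : LC X) x : rel_open Y (lcI Y (up x)).
Proof. by exists (open_hull [set x]) => //; exact: open_hull1_open. Qed.

Lemma rel_open_cl (Y : LC X) x : (Y : set X) x ->
  rel_open (cl x) (lcI Y (cl x)).
Proof.
move=> Yx; apply: rel_open_up => [z []//|a b bx [Ya ax] ab]; split=> //.
by apply: lc_convex Ya Yx ab _; [exact: lc_setP|exact/in_closure1].
Qed.

Lemma rel_closed_up (Y : LC X) x : (Y : set X) x ->
  rel_closed (up x) (lcI Y (up x)).
Proof.
move=> Yx; apply: rel_closed_down => [z []//|a b xa [Yb xb] ab]; split=> //.
by apply: lc_convex Yx Yb _ ab; [exact: lc_setP|exact/in_open_hull1].
Qed.

Lemma rel_open_trans Y Z U : rel_open Y Z -> rel_open Z U -> rel_open Y U.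
Proof.
move=> oZ oU; apply: rel_open_up => [x /(rel_open_sub oU)/(rel_open_sub oZ)//|].
move=> a b Yb Ua ab; apply: (rel_open_le oU Ua _ ab).
exact: rel_open_le oZ (rel_open_sub oU Ua) Yb ab.
Qed.

Lemma rel_closed_trans Y Z U :
  rel_closed Y Z -> rel_closed Z U -> rel_closed Y U.
Proof.
move=> oZ oU; apply: rel_closed_down => [x /(rel_closed_sub oU)/(rel_closed_sub
  oZ)//|].
move=> a b Ya Ub ab; apply: (rel_closed_le oU Ub _ ab).
exact: rel_closed_le oZ (rel_closed_sub oU Ub) Ya ab.
Qed.

Lemma rel_open_inter Y U C : rel_open Y U -> C `<=` Y -> rel_open C (U `&` C).
Proof.
move=> [V oV ->] CY; exists V => //; apply/seteqP;
  split=> [x [[_ ?] ?]|x [Cx Vx]] //.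
by split=> //; split=> //; exact: CY.
Qed.

Lemma rel_closed_inter Y U C :
  rel_closed Y C -> U `<=` Y -> rel_closed U (U `&` C).
Proof.
move=> [V oV ->] UY; exists V => //; apply/seteqP;
  split=> [x [? [_ ?]]|x [Ux Vx]] //.
by split=> //; split=> //; exact: UY.
Qed.

End LocallyClosed.

(** * Double sums over arrows *)

Section SumArrows.
Variables (X : finType) (V : zmodType).

Lemma sum_sig (P : pred X) (f : {x | P x} -> V) :
  \sum_(u : {x | P x}) f u = \sum_(x : X) oapp f 0 (insub x).
Proof.
rewrite (bigID P) /= [X in _ + X]big1 ?addr0; last first.
  by move=> x nPx; rewrite insubN.
rewrite [RHS](reindex_omap (op := +%R) (val : {x | P x} -> X) insub) /=;
  last first.
  by move=> x Px; rewrite (insubT P Px).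
by apply: eq_big => [u|u _]; rewrite /= valK ?eqxx ?(valP u).
Qed.

(** Both sides sum over all arrows, grouped by source or by target. The inner index type depends on
    the outer variable, so the sums are first extended by zero to all of X. *)
Lemma sum_arrows (e : rel X) (F : forall x y, e x y -> V) :
  \sum_x \sum_(y : {y | e x y}) F x (val y) (valP y) =
  \sum_y \sum_(x : {x | e x y}) F (val x) y (valP x).
Proof.
under eq_bigr do rewrite sum_sig.
under [RHS]eq_bigr do rewrite sum_sig.
rewrite exchange_big /=; apply: eq_bigr => y _; apply: eq_bigr => x _.
have [h|nh] := boolP (e x y); last by rewrite !insubN.
rewrite (insubT (e x) h) (insubT (e^~ y) h) /=.
by congr F; exact: bool_irrelevance.
Qed.

End SumArrows.

(** * Boundary maps over EBP spaces *)

Section BoundaryPairs.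
Variable X : finTopologicalType.
Implicit Types (x y : X) (U C : set X).

(** In terms of the order, U is open in the union of U and C when no point of U lies below a point
    of C. *)
Lemma boundary_pairI U C : (forall x, U x -> C x -> False) ->
  (forall x y, U x -> C y -> ~ spec_le x y) -> locally_closed (U `|` C) ->
  boundary_pair U C.
Proof.
move=> UC leUC lc; exists (U `|` C); split=> //.
- apply: rel_open_up => [z ?|a b [//|Cb] Ua ab]; first by left.
  by case: (leUC a b).
- apply/seteqP; split=> [z Uz|z [[//|//]]].
  by split; [left|exact: UC].
Qed.

Lemma boundary_pair_open_sub U C C' : boundary_pair U C -> rel_open C C' ->
  boundary_pair U C'.
Proof.
move=> b oC; have lc := boundary_pair_lc b; apply: boundary_pairI.
- by move=> x Ux /(rel_open_sub oC); exact: boundary_pair_disj b Ux.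
- by move=> x y Ux /(rel_open_sub oC); exact: boundary_pair_le b Ux.
apply: convex_lc => a z c aUC cUC az zc.
have sub w : (U `|` C') w -> (U `|` C) w.
  by case=> [|/(rel_open_sub oC)]; [left|right].
have [Uz|Cz] := lc_convex lc (sub a aUC) (sub c cUC) az zc; first by left.
right; case: aUC => [Ua|C'a]; first by case: (boundary_pair_le b Ua Cz).
exact: rel_open_le oC C'a Cz az.
Qed.

Lemma boundary_pair_closed_sub U U' C : boundary_pair U C -> rel_closed U U' ->
  boundary_pair U' C.
Proof.
move=> b cU; have lc := boundary_pair_lc b; apply: boundary_pairI.
- by move=> x /(rel_closed_sub cU); exact: boundary_pair_disj b.
- by move=> x y /(rel_closed_sub cU); exact: boundary_pair_le b.
apply: convex_lc => a z c aUC cUC az zc.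
have sub w : (U' `|` C) w -> (U `|` C) w.
  by case=> [/(rel_closed_sub cU)|]; [left|right].
have [Uz|Cz] := lc_convex lc (sub a aUC) (sub c cUC) az zc; last by right.
left; case: cUC => [U'c|Cc]; last by case: (boundary_pair_le b Uz Cc).
exact: rel_closed_le cU U'c Uz zc.
Qed.

Lemma closureP U x : closure U x <-> exists2 y, U y & spec_le x y.
Proof.
split=> [Ux|[y Uy /in_closure1 xy]]; last first.
  have yU : [set y] `<=` U by move=> w ->.
  exact: closureS yU _ xy.
have cD : closed [set z | exists2 y, U y & spec_le z y].
  apply: closed_down => a b ab [c Uc bc]; exists c => //.
  exact: spec_le_trans bc.
apply: cD; apply: (closureS _ Ux) => z Uz; by exists z.
Qed.

Lemma open_hullP U x : open_hull U x <-> exists2 y, U y & spec_le y x.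
Proof.
split=> [Ux|[y Uy /spec_leP yx] V [oV UV]]; last exact: yx oV (UV _ Uy).
apply: (Ux [set z | exists2 y, U y & spec_le y z]); split; last by move=> z Uz;
  exists z.
apply: open_up => a b ab [c Uc ca]; exists c => //.
exact: spec_le_trans ab.
Qed.

(** A relatively open subset containing x contains y, and a relatively closed one containing y
    contains x. *)
Lemma connected_le x y : spec_le x y -> connected [set x; y].
Proof.
move=> xy B [z Bz] oB cB.
have Bx : rel_open [set x; y] B by case: oB => V; exists V.
have By : rel_closed [set x; y] B by case: cB => V; exists V.
apply/seteqP; split=> w; first exact: rel_open_sub Bx.
suff [? ?] : B x /\ B y by case=> ->.
have [zx|zy] := rel_open_sub Bx Bz.
  move: Bz; rewrite zx => Bz; split=> //.
  by apply: rel_open_le Bx Bz _ xy; right.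
move: Bz; rewrite zy => Bz; split=> //.
by apply: rel_closed_le By Bz _ xy; left.
Qed.

Lemma component_le U x y z : U y -> U z ->
  spec_le y z \/ spec_le z y ->
  connected_component U x y -> connected_component U x z.
Proof.
move=> Uy Uz yz; move/connected_component_trans; apply.
have yzU : [set y; z] `<=` U by move=> w [] ->.
apply: (@connected_component_max _ U [set y; z]) => //; [by left| |by right].
case: yz => [/connected_le//|/connected_le]; by rewrite setUC.
Qed.

Lemma rel_open_compl U C : rel_closed U C -> rel_open U (U `\` C).
Proof.
move=> cC; apply: rel_open_up => [z []//|a b Ub [Ua nCa] ab]; split=> // Cb.
by apply: nCa; exact: rel_closed_le cC Cb Ua ab.
Qed.

Lemma rel_closed_compl Y U : rel_open Y U -> rel_closed Y (Y `\` U).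
Proof.
move=> oU; apply: rel_closed_down => [z []//|a b Ya [Yb nUb] ab]; split=> // Ua.
by apply: nUb; exact: rel_open_le oU Ua Yb ab.
Qed.

Lemma rel_closed_lc Y C :
  locally_closed Y -> rel_closed Y C -> locally_closed C.
Proof.
move=> lY cC; apply: convex_lc => a b c Ca Cc ab bc.
apply: (rel_closed_le cC Cc _ bc).
exact: lc_convex lY (rel_closed_sub cC Ca) (rel_closed_sub cC Cc) ab bc.
Qed.

End BoundaryPairs.

(** * Natural families of boundary maps that vanish on arrows *)

Section Vanishing.
Variables (X : finTopologicalType) (T0 : kolmogorov_space X).
Variables (M : st_module X).
Hypothesis EBP : forall U C : set X, elementary_boundary_pair U C ->
  exists x y, [/\ arrow x y, U = open_hull [set x] & C = closure [set y]].

Variable d : forall C U : LC X, boundary_pair U C ->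
  {additive M C true -> M U false}.
Hypothesis d_i : forall (U C C' : LC X)
    (b : boundary_pair U C) (oC' : rel_open C C') (b' : boundary_pair U C')
    (m : M C' true),
  d b (st_i M true oC' m) = d b' m.
Hypothesis d_r : forall (U C U' : LC X)
    (b : boundary_pair U C) (cU' : rel_closed U U') (b' : boundary_pair U' C)
    (m : M C true),
  st_r M false cU' (d b m) = d b' m.
Hypothesis d_ir : forall (Y Z W WY WZ : LC X),
  WY = W `\` Y :> set X -> WZ = W `\` Z :> set X ->
  locally_closed (Y `|` W) ->
  rel_closed (Y `|` W) Y -> rel_closed (Y `|` W) W ->
  locally_closed (Z `|` W) ->
  rel_open (Z `|` W) Z -> rel_open (Z `|` W) W ->
  W `<=` Y `|` Z ->
  forall (b : boundary_pair WY Y) (o : rel_open Z WY)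
    (c : rel_closed Y WZ) (b' : boundary_pair Z WZ) (m : M Y true),
  st_i M false o (d b m) = d b' (st_r M true c m).
Hypothesis d_arrow : forall x y (h : arrow x y)
    (b : boundary_pair (up x) (cl y)) m,
  d b m = 0.

(** Naturality factors the map through the pair ([up x], [cl y]): m is extended from C to [cl y],
    and the result is restricted from [up x] to U. *)
Lemma d_extend (U C : LC X) (b : boundary_pair U C) x y (h : arrow x y) m
    (bxy : boundary_pair (up x) (cl y)) :
  rel_open (cl y) C -> rel_closed (up x) U -> d b m = 0.
Proof.
move=> oC cU; have b1 := boundary_pair_closed_sub bxy cU.
by rewrite -(d_i b1 oC) -(d_r bxy cU) (d_arrow h) raddf0.
Qed.

Section Reduction.
Variables (U C : LC X) (b : boundary_pair U C).
Hypothesis IH : forall (U' C' : LC X) (b' : boundary_pair U' C'),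
  (card_set U' + card_set C' < card_set U + card_set C)%N ->
  forall m, d b' m = 0.

Let below : set X := [set z | exists2 u, (U : set X) u & spec_le z u].
Let above : set X := [set z | exists2 c, (C : set X) c & spec_le c z].

(** Let D be the part of C below U. With Y = C, Z = U and W the union of U and D, [d_ir] shows that
    d for (U, C) is restriction to D followed by d for (U, D); the point c is missing from D, so the
    pair is smaller. *)
Let shrink_C c : (C : set X) c -> ~ below c -> forall m, d b m = 0.
Proof.
move=> Cc nbc m; have lc := boundary_pair_lc b.
have cD : rel_closed C (C `&` below).
  apply: rel_closed_down => [z []//|a e Ca [Ce [u Uu eu]] ae]; split=> //.
  by exists u => //; exact: spec_le_trans eu.
pose D := MkLC (rel_closed_lc (lc_setP C) cD).
pose W : set X := U `|` D.
have CW : C `|` W = U `|` C by rewrite /W setUCA (setUidl (@subIsetl _ _ _)).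
have UW : U `|` W = W by rewrite /W setUA setUid.
have cW : rel_closed (U `|` C) W.
  apply: rel_closed_down => [z [Uz|[Cz _]]|z w UCz Ww zw]; [by left|by right|].
  have [Uz|Cz] := UCz; first by left.
  right; split=> //; case: Ww => [Uw|[_ [u Uu wu]]]; first by exists w.
  by exists u => //; exact: spec_le_trans wu.
have lW : locally_closed W by exact: rel_closed_lc lc cW.
have bD : boundary_pair U D.
  apply: boundary_pairI => [x Ux [Cx _]|x y Ux [Cy _]|//].
    exact: boundary_pair_disj b Ux Cx.
  exact: boundary_pair_le b Ux Cy.
have o := @rel_open_refl X U.
rewrite -[LHS](st_i_id o) (@d_ir C U (MkLC lW) U D _ _ _ _ _ _ _ _ _ b o cD bD)
  /=.
- apply: IH; rewrite ltn_add2l; apply: (@card_set_lt _ _ _ c) => //.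
    by move=> z [].
  by case.
- by apply/seteqP; split=> [z Uz|z [[//|[Cz _]] nCz]//]; split;
    [left|exact: boundary_pair_disj b Uz].
- apply/seteqP; split=> [z Dz|z [[//|//]]]; split; first by right.
  by case: Dz => Cz _ Uz; exact: boundary_pair_disj b Uz Cz.
- by rewrite CW.
- rewrite CW; case: (b) => Y [_ _ oU UE]; apply: rel_closed_down => [z|a e];
  first by right.
  by move=> [Ua|//] Ce ae; case: (boundary_pair_le b Ua Ce).
- by rewrite CW.
- by rewrite UW.
- rewrite UW; apply: rel_open_up => [z|a e]; first by left.
  by move=> [//|[Ce _]] Ua ae; case: (boundary_pair_le b Ua Ce).
- by rewrite UW; exact: rel_open_refl.
- by move=> z [|[Cz _]]; [right|left].
Qed.

(** Dually, with E the part of U above C and W the union of E and C, [d_ir] shows that d for (U, C)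
    is d for (E, C) followed by extension from E to U. *)
Let shrink_U u : (U : set X) u -> ~ above u -> forall m, d b m = 0.
Proof.
move=> Uu nau m; have lc := boundary_pair_lc b.
have oE : rel_open U (U `&` above).
  apply: rel_open_up => [z []//|a e Ue [Ua [c Cc ca]] ae]; split=> //.
  by exists c => //; exact: spec_le_trans ae.
pose E := MkLC (rel_open_lc (lc_setP U) oE).
pose W : set X := E `|` C.
have UW : U `|` W = U `|` C by rewrite /W setUA (setUidl (@subIsetl _ _ _)).
have CW : C `|` W = W by rewrite /W setUCA setUid.
have oW : rel_open (U `|` C) W.
  apply: rel_open_up => [z [[Uz _]|Cz]|z w UCw Wz zw]; [by left|by right|].
  have [Uw|Cw] := UCw; last by right.
  left; split=> //; case: Wz => [[_ [c Cc cz]]|Cz]; last by exists z.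
  by exists c => //; exact: spec_le_trans zw.
have lW : locally_closed W by exact: rel_open_lc lc oW.
have bE : boundary_pair E C.
  apply: boundary_pairI => [x [Ux _] Cx|x y [Ux _] Cy|//].
    exact: boundary_pair_disj b Ux Cx.
  exact: boundary_pair_le b Ux Cy.
have c := @rel_closed_refl X C.
rewrite -[m in LHS](st_r_id c).
rewrite -(@d_ir C U (MkLC lW) E C _ _ _ _ _ _ _ _ _ bE oE c b) /=.
- rewrite IH ?raddf0 // ltn_add2r; apply: (@card_set_lt _ _ _ u) => //.
    by move=> z [].
  by case.
- apply/seteqP; split=> [z Ez|z [[//|//]]]; split; first by left.
  by case: Ez => Uz _ Cz; exact: boundary_pair_disj b Uz Cz.
- by apply/seteqP; split=> [z Cz|z [[[Uz _]|//] nUz]//]; split;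
    [right|move=> Uz; exact: boundary_pair_disj b Uz Cz].
- by rewrite CW.
- rewrite CW; apply: rel_closed_down => [z|a e]; first by right.
  by move=> [[Ua _]|//] Ce ae; case: (boundary_pair_le b Ua Ce).
- by rewrite CW; exact: rel_closed_refl.
- by rewrite UW.
- rewrite UW; apply: rel_open_up => [z|a e]; first by left.
  by move=> [//|Ce] Ua ae; case: (boundary_pair_le b Ua Ce).
- by rewrite UW.
- by move=> z [[Uz _]|Cz]; [right|left].
Qed.

Let split_parts (Y : LC X) (B : set X) :
  B !=set0 -> rel_open Y B -> rel_closed Y B -> B <> Y ->
  exists Y1 Y2 : LC X, [/\ rel_open Y Y1 /\ rel_closed Y Y1,
    rel_open Y Y2 /\ rel_closed Y Y2, topologically_disjoint Y1 Y2,
    Y = Y1 `|` Y2 :> set X &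
    (card_set Y1 < card_set Y)%N /\ (card_set Y2 < card_set Y)%N].
Proof.
move=> [z0 Bz0] oB cB BY.
have oB' := rel_open_compl cB; have cB' := rel_closed_compl oB.
have BsubY : B `<=` Y by move=> z /(rel_open_sub oB).
have YE : Y = B `|` Y `\` B :> set X by rewrite setDUK.
have [z1 [Yz1 nBz1]] : exists z, (Y : set X) z /\ ~ B z.
  apply: contrapT => nz; apply: BY; apply/seteqP; split=> // z Yz.
  by apply: contrapT => nBz; apply: nz; exists z.
exists (MkLC (rel_open_lc (lc_setP Y) oB)), (MkLC (rel_open_lc (lc_setP Y)
  oB')).
split=> //=.
- split; rewrite -?YE //.
  by rewrite -subset0 => z [Bz []].
- split; [exact: (@card_set_lt _ _ _ z1)|apply: (@card_set_lt _ _ _ z0)].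
  + by move=> z [].
  + by case.
  + exact: BsubY.
Qed.

Let not_connected (Y : set X) : ~ connected Y ->
  exists B, [/\ B !=set0, rel_open Y B, rel_closed Y B & B <> Y].
Proof.
move=> nY; apply: contrapT => nB; apply: nY => B B0 oB cB.
by apply: contrapT => BY; apply: nB; exists B.
Qed.

(** By [st_disjoint], m is a sum of elements extended from two proper clopen parts, and [d_i] passes
    to the smaller pairs. *)
Let disconnected_C : ~ connected C -> forall m, d b m = 0.
Proof.
move=> /not_connected[B [B0 oB cB BC]] m.
have [Y1 [Y2 [[o1 c1] [o2 c2] dj YE [lt1 lt2]]]] := split_parts B0 oB cB BC.
have b1 := boundary_pair_open_sub b o1; have b2 := boundary_pair_open_sub b o2.
rewrite -(st_disjoint dj YE o1 c1 o2 c2 m) raddfD /= (d_i b o1 b1) (d_i b o2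
  b2).
by rewrite !IH ?addr0 // ltn_add2l.
Qed.

Let disconnected_U : ~ connected U -> forall m, d b m = 0.
Proof.
move=> /not_connected[B [B0 oB cB BC]] m.
have [Y1 [Y2 [[o1 c1] [o2 c2] dj YE [lt1 lt2]]]] := split_parts B0 oB cB BC.
have b1 := boundary_pair_closed_sub b c1; have b2 :=
  boundary_pair_closed_sub b c2.
rewrite -(st_disjoint dj YE o1 c1 o2 c2 (d b m)) (d_r b c1 b1) (d_r b c2 b2).
by rewrite !IH ?raddf0 ?addr0 // ltn_add2r.
Qed.

(* Once U and C are connected, U lies above C and C lies below U, the closure
   of C and the component of U in the complement of that closure inside its
   open hull form an elementary boundary pair (up x, cl y); convexity of
   U `|` C then puts x in U and y in C. *)
Lemma d_vanish_step m : d b m = 0.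
Proof.
have [[u0 Uu0]|U0] := pselect (exists u, (U : set X) u); last first.
  by apply: st_set0; rewrite -subset0 => u Uu; apply: U0; exists u.
have [[c0 Cc0]|C0] := pselect (exists c, (C : set X) c); last first.
  rewrite (@st_set0 _ M true C m) ?raddf0 //.
  by rewrite -subset0 => c Cc; apply: C0; exists c.
have [Cbelow|/existsNP[c /not_implyP[Cc nbc]]] :=
  pselect (forall c, (C : set X) c -> below c); last exact: shrink_C nbc m.
have [Uabove|/existsNP[u /not_implyP[Uu nau]]] :=
  pselect (forall u, (U : set X) u -> above u); last exact: shrink_U nau m.
have [conC|/disconnected_C] := pselect (connected C); last exact.
have [conU|/disconnected_U] := pselect (connected U); last exact.
pose C' := closure C.
pose V := open_hull C' `\` C'.
have C'P z : C' z <-> exists2 c, (C : set X) c & spec_le z c by exact: closureP.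
have C'down a e : C' e -> spec_le a e -> C' a.
  by move=> /C'P[c Cc ec] ae; apply/C'P; exists c => //;
    exact: spec_le_trans ec.
have VP z : V z <-> (exists2 c, C' c & spec_le c z) /\ ~ C' z.
  by split=> -[/open_hullP ? ?]; split=> //; exact/open_hullP.
have Vup a e : V a -> spec_le a e -> V e.
  move=> /VP[[c Cc ca] nCa] ae; apply/VP; split.
    by exists c => //; exact: spec_le_trans ae.
  by move=> /C'down/(_ ae).
have CC' : C `<=` C' by exact: subset_closure.
have UV : U `<=` V.
  move=> u Uu; apply/VP; split.
    by have [c Cc cu] := Uabove u Uu; exists c => //; exact: CC'.
  by move=> /C'P[c Cc uc]; exact: boundary_pair_le b Uu Cc uc.
(* V itself may be disconnected; the component of u0 still contains all of the connected set U. *)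
pose U' := connected_component V u0.
have UU' : U `<=` U' by exact: connected_component_max.
have U'V : U' `<=` V by exact: connected_component_sub.
have U'up a e : U' a -> spec_le a e -> U' e.
  move=> U'a ae; have Va := U'V _ U'a.
  by apply: component_le (Va) (Vup _ _ Va ae) _ U'a; left.
have bp' : boundary_pair U' C'.
  apply: boundary_pairI => [x /U'V[_ nCx]//|x y /U'V[_ nCx] C'y xy|].
    by apply: nCx; exact: C'down C'y xy.
  apply: convex_lc => a z e aUC eUC az ze.
  have [C'z|nC'z] := pselect (C' z); first by right.
  have U'e : U' e by case: eUC => // C'e; case: nC'z; exact: C'down C'e ze.
  have Vz : V z.
    case: aUC => [/U'V Va|C'a]; first exact: Vup Va az.
    by apply/VP; split=> //; exists a.
  by left; apply: component_le (U'V _ U'e) Vz _ U'e; right.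
have [|x [y [xy U'E C'E]]] := EBP (U := U') (C := C').
  split=> //; split.
  - by split; [exact: component_connected|exists u0; exact: UU'].
  - by split; [exact: connected_closure|exists c0; exact: CC'].
  - by apply: open_up => a e ae U'a; exact: U'up U'a ae.
  - exact: closed_closure.
  - split=> z; first by move=> /U'V/VP[/open_hullP].
    move=> /C'P[c Cc zc]; apply/closureP; have [u Uu cu] := Cbelow c Cc.
    by exists u; [exact: UU'|exact: spec_le_trans cu].
have U'x : U' x by rewrite U'E; exact/in_open_hull1.
have C'y : C' y by rewrite C'E; exact/in_closure1.
(* The point y is the largest point of C', and every point of C' lies below a point of C. *)
have Cy : (C : set X) y.
  have [c Cc yc] := iffLR (C'P y) C'y.
  have : C' c by exact: CC'.
  by rewrite C'E => /in_closure1 cy; rewrite (spec_le_anti T0 yc cy).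
have lc := boundary_pair_lc b.
(* The point x lies between y in C and u0 in U, so convexity puts it in U or C; as a point of V it
   is not in C'. *)
have Ux : (U : set X) x.
  have : U' u0 by exact: UU'.
  rewrite U'E => /in_open_hull1 xu.
  have [//|/CC' C'x] := lc_convex (b := x) lc (or_intror Cy) (or_introl Uu0)
    (arrow_le xy) xu.
  by have [_ []] := U'V _ U'x.
have bxy : boundary_pair (up x) (cl y) by rewrite /= -U'E -C'E.
apply: (d_extend b xy m bxy).
- apply: rel_open_up => [z /CC'|a e]; first by rewrite C'E.
  move=> /in_closure1 ey Ca ae.
  have [Ue|//] := lc_convex lc (or_intror Ca) (or_intror Cy) ae ey.
  by case: (boundary_pair_le b Ue Cy).
- apply: rel_closed_down => [z /UU'|a e]; first by rewrite U'E.
  move=> /in_open_hull1 xa Ue ae.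
  have [//|Ca] := lc_convex lc (or_introl Ux) (or_introl Ue) xa ae.
  by case: (boundary_pair_le b Ux Ca).
Qed.

End Reduction.

Lemma d_vanish (U C : LC X) (b : boundary_pair U C) m : d b m = 0.
Proof.
have [n] := ubnP (card_set U + card_set C).
elim: n U C b m => // n IH U C b m; rewrite ltnS => n_ge.
apply: d_vanish_step => U' C' b' lt m'; apply: IH.
exact: leq_trans n_ge.
Qed.

End Vanishing.

(** * Exactness of F(M) *)

Section Punctured.
Variables (X : finTopologicalType) (T0 : kolmogorov_space X).
Variables (UP : unique_path_space X) (x : X).
Implicit Types (y z : X).

Lemma pcl_closed : closed (cl x `\ x).
Proof.
apply: closed_down => a b ab [/in_closure1 bx nbx]; split.
  exact/in_closure1/(spec_le_trans ab).
by move=> ax; apply: nbx; apply: spec_le_anti => //; rewrite -ax.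
Qed.

Lemma pup_open : open (up x `\ x).
Proof.
apply: open_up => a b ab [/in_open_hull1 xa nxa]; split.
  exact/in_open_hull1/(spec_le_trans xa).
by move=> bx; apply: nxa; apply: spec_le_anti => //; rewrite -bx.
Qed.

Lemma closed_lc (C : set X) : closed C -> locally_closed C.
Proof. by move=> cC; exists setT, C; split; [exact: openT| |rewrite setTI]. Qed.

Lemma open_lc (U : set X) : open U -> locally_closed U.
Proof.
move=> oU; exists U, setT.
by split; [|exact: closedT|rewrite setIT].
Qed.

Lemma point_lc y : locally_closed [set y].
Proof.
by apply: convex_lc => a b c /= -> -> ab bc; exact: spec_le_anti.
Qed.

(** The point [pt] is open in [cl x] with complement [pcl] and closed in [up x] with complement
    [pup]. The two resulting six-term sequences through M at [pt] carry the argument at x. *)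
Definition pcl : LC X := MkLC (closed_lc pcl_closed).
Definition pup : LC X := MkLC (open_lc pup_open).
Definition pt : LC X := MkLC (point_lc x).

Lemma pclP z : (pcl : set X) z <-> spec_lt z x.
Proof. by split=> -[/in_closure1 zx nzx]; split=> //; exact/in_closure1. Qed.

Lemma pupP z : (pup : set X) z <-> spec_lt x z.
Proof.
split=> -[] => [/in_open_hull1 xz nzx|xz nzx]; split=> //.
- by move=> /esym.
- exact/in_open_hull1.
- by move=> /esym.
Qed.

Lemma pcl_rel_closed : rel_closed (cl x) pcl.
Proof. by apply: rel_closed_closed; [exact: pcl_closed|exact: subDsetl]. Qed.

Lemma pup_rel_open : rel_open (up x) pup.
Proof. by apply: rel_open_open; [exact: pup_open|exact: subDsetl]. Qed.

Lemma pcl_compl : pcl = cl x `\` pt :> set X. Proof. by []. Qed.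

Lemma pt_compl : pt = up x `\` pup :> set X.
Proof.
apply/seteqP; split=> z /= => [->|[xz nz]].
  by split; [exact/in_open_hull1|case=> _; apply].
by apply: contrapT => nzx; apply: nz.
Qed.

Lemma pt_rel_open : rel_open (cl x) pt.
Proof.
have -> : pt = cl x `\` pcl :> set X.
  apply/seteqP; split=> z /= => [->|[xz nz]].
    by split; [exact/in_closure1|case=> _; apply].
  by apply: contrapT => nzx; apply: nz.
exact: rel_open_compl pcl_rel_closed.
Qed.

Lemma pt_rel_closed : rel_closed (up x) pt.
Proof. by rewrite pt_compl; exact: rel_closed_compl pup_rel_open. Qed.

Let upcl z : (up x : set X) z -> (cl x : set X) z -> z = x.
Proof. by move=> /in_open_hull1 xz /in_closure1 zx; exact: spec_le_anti. Qed.

Lemma up_pcl : boundary_pair (up x) pcl.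
Proof.
apply: boundary_pairI => [z xz [zx]|a b /in_open_hull1 xa /pclP[bx nbx] ab|].
- by apply; exact: upcl.
- by apply: nbx; apply: spec_le_anti => //; exact: spec_le_trans ab.
suff -> : up x `|` pcl = open_hull [set x] `|` closure [set x]
  by exact: star_lc.
apply/seteqP; split=> z [|zx]; [by left|by case: zx; right|by left|].
have [->|zx'] := pselect (z = x); last by right.
by left; exact/in_open_hull1.
Qed.

Lemma pup_cl : boundary_pair pup (cl x).
Proof.
apply: boundary_pairI => [z [xz nz] zx|a b /pupP[xa nxa] /in_closure1 bx ab|].
- by apply: nz; exact: upcl.
- apply: nxa; apply: spec_le_anti => //; exact: spec_le_trans bx.
suff -> : pup `|` cl x = open_hull [set x] `|` closure [set x]
  by exact: star_lc.
apply/seteqP; split=> z [zx|]; [by case: zx; left|by right| |by right].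
have [->|zx'] := pselect (z = x); last by left.
by right; exact/in_closure1.
Qed.

Lemma pt_pcl : boundary_pair pt pcl.
Proof. exact: boundary_pair_closed_sub up_pcl pt_rel_closed. Qed.

Lemma pup_pt : boundary_pair pup pt.
Proof. exact: boundary_pair_open_sub pup_cl pt_rel_open. Qed.

(** By uniqueness of paths, a point strictly below x lies in [cl y] for exactly one arrow x -> y, so
    a larger point b of [pcl] stays in the same closure. Hence [pcl] is a topological disjoint union
    of these closures. *)
Lemma pcl_open_cl y (h : arrow x y) : rel_open pcl (cl y).
Proof.
apply: rel_open_up => [z /in_closure1 zy|a b /pclP bx /in_closure1 ay ab].
  apply/pclP; split; first exact: spec_le_trans (arrow_le h).
  have [yx] := arrow_lt h; apply: contra_not => zx.
  by apply: spec_le_anti => //; rewrite -zx.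
have [y' xy' by'] := arrow_above T0 bx.
apply/in_closure1; rewrite (arrow_above_inj T0 UP h xy' ay) //.
exact: spec_le_trans by'.
Qed.

Lemma pcl_closed_cl y (h : arrow x y) : rel_closed pcl (cl y).
Proof.
apply: rel_closed_closed; first exact: closed_closure.
by move=> z /(rel_open_sub (pcl_open_cl h)).
Qed.

Lemma pup_closed_up z (h : arrow z x) : rel_closed pup (up z).
Proof.
apply: rel_closed_down => [w /in_open_hull1 zw|a b /pupP xa /in_open_hull1 zb
  ab].
  apply/pupP; split; first exact: spec_le_trans (arrow_le h) zw.
  have [xz] := arrow_lt h; apply: contra_not => xw.
  by apply: spec_le_anti => //; rewrite xw.
have [z' z'x z'a] := arrow_below T0 xa.
apply/in_open_hull1; rewrite (arrow_below_inj T0 UP h z'x zb) //.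
exact: spec_le_trans ab.
Qed.

Lemma pup_open_up z (h : arrow z x) : rel_open pup (up z).
Proof.
apply: rel_open_open; first exact: open_hull1_open.
by move=> w /(rel_closed_sub (pup_closed_up h)).
Qed.

Lemma cl_disjoint (y y' : {y | arrow x y}) : y != y' ->
  cl (val y) `&` cl (val y') = set0.
Proof.
move=> /eqP ne; rewrite -subset0 => z [/in_closure1 zy /in_closure1 zy'].
by apply/ne/val_inj; exact: (arrow_above_inj T0 UP (valP y) (valP y') zy zy').
Qed.

Lemma up_disjoint (z z' : {z | arrow z x}) : z != z' ->
  up (val z) `&` up (val z') = set0.
Proof.
move=> /eqP ne; rewrite -subset0 => w [/in_open_hull1 zy /in_open_hull1 zy'].
by apply/ne/val_inj; exact: (arrow_below_inj T0 UP (valP z) (valP z') zy zy').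
Qed.

Variable M : st_module X.

Lemma pcl_split j (m : M pcl j) :
  \sum_(y : {y | arrow x y}) st_i M j (pcl_open_cl (valP y))
     (st_r M j (pcl_closed_cl (valP y)) m) = m.
Proof.
have := @st_split _ M j {y | arrow x y} pcl
  (fun y : {y | arrow x y} => cl (val y)) cl_disjoint
  (fun y : {y | arrow x y} => pcl_open_cl (valP y))
  (fun y : {y | arrow x y} => pcl_closed_cl (valP y)) m.
apply=> z /pclP/(arrow_above T0)[y xy zy].
by exists (exist _ y xy); exact/in_closure1.
Qed.

Lemma pup_split j (m : M pup j) :
  \sum_(z : {z | arrow z x}) st_i M j (pup_open_up (valP z))
     (st_r M j (pup_closed_up (valP z)) m) = m.
Proof.
have := @st_split _ M j {z | arrow z x} pup
  (fun z : {z | arrow z x} => up (val z)) up_disjoint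
  (fun z : {z | arrow z x} => pup_open_up (valP z))
  (fun z : {z | arrow z x} => pup_closed_up (valP z)) m.
apply=> z /pupP/(arrow_below T0)[y xy zy].
by exists (exist _ y xy); exact/in_open_hull1.
Qed.

(** By [st_ir], extending from [cl y'] and restricting to another [cl y] factors through the empty
    set; only the summand at y survives. *)
Lemma pcl_glue j (a : forall y : {y | arrow x y}, M (cl (val y)) j)
    (y : {y | arrow x y}) :
  st_r M j (pcl_closed_cl (valP y))
    (\sum_(y : {y | arrow x y}) st_i M j (pcl_open_cl (valP y)) (a y)) = a y.
Proof.
rewrite raddf_sum (bigD1 y) //= [X in _ + X]big1 ?addr0.
  rewrite (@st_ir _ M _ _ _ (cl (val y)) j _ _ _ (rel_closed_refl _)
    (rel_open_refl _)).
    by rewrite st_r_id st_i_id.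
  by rewrite setIid.
move=> y' ne; pose K : LC X := lcI (cl (val y')) (cl (val y)).
have K0 : K = set0 :> set X by exact: cl_disjoint.
have cK : rel_closed (cl (val y')) K.
  by apply: rel_closed_down; rewrite K0 // => a b.
have oK : rel_open (cl (val y)) K.
  by apply: rel_open_up; rewrite K0 // => a b.
rewrite (@st_ir _ M _ _ _ K j _ _ _ cK oK) //.
by rewrite [X in st_i _ _ _ X]st_set0 ?raddf0.
Qed.

Lemma pup_glue j (a : forall z : {z | arrow z x}, M (up (val z)) j)
    (z : {z | arrow z x}) :
  st_r M j (pup_closed_up (valP z))
    (\sum_(z : {z | arrow z x}) st_i M j (pup_open_up (valP z)) (a z)) = a z.
Proof.
rewrite raddf_sum (bigD1 z) //= [X in _ + X]big1 ?addr0.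
  rewrite (@st_ir _ M _ _ _ (up (val z)) j _ _ _ (rel_closed_refl _)
    (rel_open_refl _)).
    by rewrite st_r_id st_i_id.
  by rewrite setIid.
move=> y' ne; pose K : LC X := lcI (up (val y')) (up (val z)).
have K0 : K = set0 :> set X by exact: up_disjoint.
have cK : rel_closed (up (val y')) K.
  by apply: rel_closed_down; rewrite K0 // => a b.
have oK : rel_open (up (val z)) K.
  by apply: rel_open_up; rewrite K0 // => a b.
rewrite (@st_ir _ M _ _ _ K j _ _ _ cK oK) //.
by rewrite [X in st_i _ _ _ X]st_set0 ?raddf0.
Qed.

(** The lemma [st_center] speaks of its own copies of the punctured sets; [irr] identifies these
    with [pcl] and [pup] by proof irrelevance. *)
Lemma st_center_pcl j (m : M (cl x) j) :
  st_i M (~~ j) pup_rel_open (st_d M j pup_cl m) =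
  st_d M j up_pcl (st_r M j pcl_rel_closed m).
Proof.
have irr (A B : LC X) (eA : A = pcl) (eB : B = pup)
    (o : rel_open (up x) B) (b : boundary_pair B (cl x))
    (b' : boundary_pair (up x) A) (c : rel_closed (cl x) A) :
    st_i M (~~ j) o (st_d M j b m) = st_d M j b' (st_r M j c m) ->
    st_i M (~~ j) pup_rel_open (st_d M j pup_cl m) =
    st_d M j up_pcl (st_r M j pcl_rel_closed m).
  move: o b b' c; rewrite eA eB => o b b' c.
  by rewrite (Prop_irrelevance o pup_rel_open) (Prop_irrelevance b pup_cl)
    (Prop_irrelevance b' up_pcl) (Prop_irrelevance c pcl_rel_closed).
by apply: irr (st_center T0 UP m); exact: LC_eq.
Qed.

(** Glued to a' on [pcl] and c' on [pup], the hypothesis reads d a' + i c' = 0. Restricting it to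
    the point kills the boundary of a', so a' lifts to some n on [cl x]. Then i kills c' + d n,
    which is thus the boundary of some k on the point, and n - i k is the required element. *)
Lemma FB_obj_exact_at (a : forall y : {y | arrow x y}, M (cl (val y)) true)
    (c : forall z : {z | arrow z x}, M (up (val z)) false) :
  st_exact M ->
  \sum_(y : {y | arrow x y}) b_d (FB_obj T0 UP M) (valP y) (a y) +
    \sum_(z : {z | arrow z x}) b_i (FB_obj T0 UP M) (valP z) (c z) = 0 ->
  exists n : M (cl x) true,
    (forall y : {y | arrow x y}, a y = b_r (FB_obj T0 UP M) (valP y) n) /\
    (forall z : {z | arrow z x}, c z = - b_d (FB_obj T0 UP M) (valP z) n).
Proof.
move=> exM ac0.
pose a' := \sum_(y : {y | arrow x y}) st_i M true (pcl_open_cl (valP y)) (a y).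
pose c' := \sum_(z : {z | arrow z x}) st_i M false (pup_open_up (valP z)) (c z).
have da : st_d M true up_pcl a' =
    \sum_(y : {y | arrow x y}) b_d (FB_obj T0 UP M) (valP y) (a y).
  rewrite raddf_sum; apply: eq_bigr => y _.
  exact: (st_id up_pcl (pcl_open_cl (valP y))
    (arrow_boundary_pair T0 UP (valP y))).
have ic : st_i M false pup_rel_open c' =
    \sum_(z : {z | arrow z x}) b_i (FB_obj T0 UP M) (valP z) (c z).
  rewrite raddf_sum; apply: eq_bigr => z _.
  exact: (st_ii (pup_open_up (valP z)) pup_rel_open (arrow_rel_open (valP z))).
have [exU _ _] := exM pup (up x) pt pup_rel_open pt_rel_closed pup_pt pt_compl
  false.
have [_ exC _] := exM pt (cl x) pcl pt_rel_open pcl_rel_closed pt_pcl pcl_compl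
  true.
have [_ _ exI] := exM pup (up x) pt pup_rel_open pt_rel_closed pup_pt pt_compl
  true.
have [|n ra] := iffLR (exC a').
  rewrite -(st_dr up_pcl pt_rel_closed pt_pcl).
  have -> : st_d M true up_pcl a' = - st_i M false pup_rel_open c'.
    by apply/eqP; rewrite -addr_eq0 da ic ac0.
  by apply/exU; exists (- c'); rewrite raddfN.
have [|k kE] := iffLR (exI (c' + st_d M true pup_cl n)).
  rewrite raddfD /= [X in _ + X](@st_center_pcl true) ra.
  by rewrite [X in _ + X]da [X in X + _]ic addrC.
exists (n - st_i M true pt_rel_open k).
have ra' : st_r M true pcl_rel_closed (n - st_i M true pt_rel_open k) = a'.
  rewrite raddfB ra /=.
  have [exK _ _] := exM pt (cl x) pcl pt_rel_open pcl_rel_closed pt_pcl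
    pcl_compl true.
  by rewrite (iffRL (exK _)) ?subr0 //; exists k.
have dc' : st_d M true pup_cl (n - st_i M true pt_rel_open k) = - c'.
  by rewrite raddfB /= (st_id pup_cl pt_rel_open pup_pt) kE opprD addrCA subrr
    addr0.
split=> [y|z].
  rewrite -[a y](pcl_glue a) -/a' -ra'.
  exact: (st_rr pcl_rel_closed (pcl_closed_cl (valP y))
    (arrow_rel_closed (valP y))).
rewrite -[c z](pup_glue c) -/c' -[c']opprK -dc' raddfN; congr (- _).
exact: (@st_dr _ M _ _ _ true pup_cl (pup_closed_up (valP z))
  (arrow_boundary_pair T0 UP (valP z))).
Qed.

End Punctured.

Lemma FB_obj_exact (X : finTopologicalType) (T0 : kolmogorov_space X)
    (UP : unique_path_space X) (M : st_module X) :
  st_exact M -> b_exact (FB_obj T0 UP M).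
Proof.
move=> exM x a c; split=> [|[n [an cn]]]; first exact: FB_obj_exact_at.
under eq_bigr do rewrite an.
under [X in _ + X]eq_bigr do rewrite cn raddfN.
by rewrite sumrN b_rel subrr.
Qed.

(** * Comparison of M with G(F(M)) *)

Section Comparison.
Variables (X : finTopologicalType) (T0 : kolmogorov_space X).
Variables (UP : unique_path_space X) (M : st_module X).
Implicit Types (x y : X) (Y U C K : LC X).

Local Notation FM := (FB_obj T0 UP M).

(** The intersection of Y with [cl x] is closed in Y and, by convexity of Y, open in [cl x]. *)
Definition through_cl Y x (Yx : (Y : set X) x) :
  {additive M Y true -> M (cl x) true} :=
  st_i M true (rel_open_cl Yx) \o st_r M true (rel_closed_cl Y x).

Definition through_up Y x (Yx : (Y : set X) x) :
  {additive M (up x) false -> M Y false} :=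
  st_i M false (rel_open_up1 Y x) \o st_r M false (rel_closed_up Yx).

Definition to_cl Y x : {additive M Y true -> M (cl x) true} :=
  if pselect ((Y : set X) x) is left Yx then through_cl Yx else \0.

Definition of_up Y x : {additive M (up x) false -> M Y false} :=
  if pselect ((Y : set X) x) is left Yx then through_up Yx else \0.

Lemma to_cl_out Y x m : ~ (Y : set X) x -> to_cl Y x m = 0.
Proof. by rewrite /to_cl; case: pselect. Qed.

Lemma of_up_out Y x n : ~ (Y : set X) x -> of_up Y x n = 0.
Proof. by rewrite /of_up; case: pselect. Qed.

(** Allows the intermediate set to be any K with the right underlying set, with any proofs of
    openness and closedness. *)
Lemma to_clE Y x K (o : rel_open (cl x) K) (c : rel_closed Y K) m :
  (Y : set X) x -> K = Y `&` cl x :> set X ->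
  to_cl Y x m = st_i M true o (st_r M true c m).
Proof.
move=> Yx KE; rewrite /to_cl; case: pselect => // Yx'.
have {}KE : K = lcI Y (cl x) by exact: LC_eq.
move: o c; rewrite KE => o c.
by rewrite (Prop_irrelevance o (rel_open_cl Yx')) (Prop_irrelevance c
  (rel_closed_cl Y x)).
Qed.

Lemma of_upE Y x K (o : rel_open Y K) (c : rel_closed (up x) K) n :
  (Y : set X) x -> K = Y `&` up x :> set X ->
  of_up Y x n = st_i M false o (st_r M false c n).
Proof.
move=> Yx KE; rewrite /of_up; case: pselect => // Yx'.
have {}KE : K = lcI Y (up x) by exact: LC_eq.
move: o c; rewrite KE => o c.
by rewrite (Prop_irrelevance o (rel_open_up1 Y x)) (Prop_irrelevance c
  (rel_closed_up Yx')).
Qed.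

Lemma cl_le x y : arrow x y -> (cl y : set X) `<=` cl x.
Proof. by move=> /arrow_le. Qed.

Lemma up_le x y : arrow x y -> (up x : set X) `<=` up y.
Proof.
move=> /arrow_le yx z /in_open_hull1 xz; apply/in_open_hull1.
exact: spec_le_trans xz.
Qed.

(** By [st_ir] the left side factors through the intersection of Y with [cl y]; if y is off Y, this
    set is empty by convexity. *)
Lemma to_cl_r Y x y (h : arrow x y) m : (Y : set X) x ->
  st_r M true (arrow_rel_closed h) (to_cl Y x m) = to_cl Y y m.
Proof.
move=> Yx.
rewrite (to_clE (rel_open_cl Yx) (rel_closed_cl Y x)) //.
have UCE : lcI Y (cl y) = lcI Y (cl x) `&` cl y :> set X.
  by rewrite /= -setIA (setIidr (cl_le h)).
have oUC : rel_open (cl y) (lcI Y (cl y)).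
  by rewrite UCE; apply: rel_open_inter (cl_le h); exact: rel_open_cl.
have cUC : rel_closed (lcI Y (cl x)) (lcI Y (cl y)).
  by rewrite UCE; apply: rel_closed_inter (arrow_rel_closed h) _;
    exact: subIsetr.
rewrite (st_ir UCE _ _ cUC oUC) (st_rr _ _ (rel_closed_cl Y y)).
have [Yy|nYy] := pselect ((Y : set X) y); first by rewrite -to_clE.
rewrite to_cl_out // [X in st_i _ _ _ X]st_set0 ?raddf0 //.
rewrite -subset0 => z /= [Yz /in_closure1 zy]; apply: nYy.
apply: lc_convex Yz Yx zy (arrow_le h); exact: lc_setP.
Qed.

Lemma of_up_i Y x y (h : arrow x y) n : (Y : set X) y ->
  of_up Y y (st_i M false (arrow_rel_open h) n) = of_up Y x n.
Proof.
move=> Yy.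
rewrite (of_upE (rel_open_up1 Y y) (rel_closed_up Yy)) //.
have UCE : lcI Y (up x) = up x `&` lcI Y (up y) :> set X.
  by rewrite setICA (setIidl (up_le h)).
have oUC : rel_open (lcI Y (up y)) (lcI Y (up x)).
  by rewrite UCE; apply: rel_open_inter (arrow_rel_open h) _; exact: subIsetr.
have cUC : rel_closed (up x) (lcI Y (up x)).
  by rewrite UCE; apply: rel_closed_inter (rel_closed_up Yy) (up_le h).
rewrite (st_ir UCE _ _ cUC oUC) (st_ii _ _ (rel_open_up1 Y x)).
have [Yx|nYx] := pselect ((Y : set X) x); first by rewrite -of_upE.
rewrite of_up_out // [X in st_i _ _ _ X]st_set0 ?raddf0 //.
rewrite -subset0 => z /= [Yz /in_open_hull1 xz]; apply: nYx.
apply: lc_convex Yy Yz (arrow_le h) xz; exact: lc_setP.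
Qed.

(** The left side factors through the intersection of U with [cl x], which is empty for x in Y \ U
    because U is upward closed in Y. *)
Lemma to_cl_i U Y (o : rel_open Y U) x m :
  to_cl Y x (st_i M true o m) = to_cl U x m.
Proof.
have [Yx|nYx] := pselect ((Y : set X) x); last first.
  by rewrite !to_cl_out // => /(rel_open_sub o).
rewrite (to_clE (rel_open_cl Yx) (rel_closed_cl Y x)) //.
have UY : U `<=` Y by move=> z /(rel_open_sub o).
have UCE : lcI U (cl x) = U `&` lcI Y (cl x) :> set X.
  by rewrite /= setIA (setIidl UY).
have oUC : rel_open (lcI Y (cl x)) (lcI U (cl x)).
  by rewrite UCE; apply: rel_open_inter o _; exact: subIsetl.
rewrite (st_ir UCE _ _ (rel_closed_cl U x) oUC).
have oK := rel_open_trans (rel_open_cl Yx) oUC.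
rewrite (st_ii _ _ oK).
have [Ux|nUx] := pselect ((U : set X) x); first by rewrite -to_clE.
rewrite to_cl_out // [X in st_i _ _ _ X]st_set0 ?raddf0 //.
rewrite -subset0 => z /= [Uz /in_closure1 zx]; apply: nUx.
exact: rel_open_le o Uz Yx zx.
Qed.

Lemma to_cl_r_closed Y C (c : rel_closed Y C) x m : (C : set X) x ->
  to_cl C x (st_r M true c m) = to_cl Y x m.
Proof.
move=> Cx; rewrite (to_clE (rel_open_cl Cx) (rel_closed_cl C x)) //.
have cK := rel_closed_trans c (rel_closed_cl C x).
rewrite (st_rr _ _ cK) -to_clE //; first exact: rel_closed_sub c Cx.
apply/seteqP; split=> z /= [Cz zx]; split=> //;
  first exact: rel_closed_sub c Cz.
by apply: rel_closed_le c Cx Cz _; exact/in_closure1.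
Qed.

Lemma of_up_r Y C (c : rel_closed Y C) x n :
  st_r M false c (of_up Y x n) = of_up C x n.
Proof.
have [Yx|nYx] := pselect ((Y : set X) x); last first.
  by rewrite !of_up_out ?raddf0 // => /(rel_closed_sub c).
rewrite (of_upE (rel_open_up1 Y x) (rel_closed_up Yx)) //.
have CY : C `<=` Y by move=> z /(rel_closed_sub c).
have UCE : lcI C (up x) = lcI Y (up x) `&` C :> set X.
  by rewrite /= setIAC (setIidr CY).
have cUC : rel_closed (lcI Y (up x)) (lcI C (up x)).
  by rewrite UCE; apply: rel_closed_inter c _; exact: subIsetl.
rewrite (st_ir UCE _ _ cUC (rel_open_up1 C x)).
have cK := rel_closed_trans (rel_closed_up Yx) cUC.
rewrite (st_rr _ _ cK).
have [Cx|nCx] := pselect ((C : set X) x); first by rewrite -of_upE.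
rewrite of_up_out // [X in st_i _ _ _ X]st_set0 ?raddf0 //.
rewrite -subset0 => z /= [Cz /in_open_hull1 xz]; apply: nCx.
exact: rel_closed_le c Cz Yx xz.
Qed.

Lemma of_up_i_open U Y (o : rel_open Y U) x n : (U : set X) x ->
  st_i M false o (of_up U x n) = of_up Y x n.
Proof.
move=> Ux; rewrite (of_upE (rel_open_up1 U x) (rel_closed_up Ux)) //.
have oK := rel_open_trans o (rel_open_up1 U x).
rewrite (st_ii _ _ oK) -of_upE //; first exact: rel_open_sub o Ux.
apply/seteqP; split=> z /= [Uz xz]; split=> //; first exact: rel_open_sub o Uz.
by apply: rel_open_le o Ux Uz _; exact/in_open_hull1.
Qed.

Definition beta_fam Y (m : M Y true) : fam (b1 FM) := fun x => to_cl Y x m.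

Fact beta_subproof Y (m : M Y true) : sg_set (sections FM Y) (beta_fam m).
Proof.
split=> [x nYx|x y h Yx]; first exact: to_cl_out.
exact: to_cl_r.
Qed.

Definition beta Y (m : M Y true) : gb_obj FM Y true := to_sub (beta_subproof m).

Fact beta_is_additive Y : zmod_morphism (@beta Y).
Proof.
by move=> u v; apply: val_inj; apply: fam_ext => x; rewrite /= /beta_fam raddfB.
Qed.

HB.instance Definition _ Y :=
  GRing.isZmodMorphism.Build _ _ (@beta Y) (@beta_is_additive Y).

Definition alpha_fam Y (v : fam (b0 FM)) : M Y false := \sum_x of_up Y x (v x).

Fact alpha_fam_is_additive Y : zmod_morphism (@alpha_fam Y).
Proof.
by move=> u v; rewrite -sumrB; apply: eq_bigr => x _; rewrite famB raddfB.
Qed.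

HB.instance Definition _ Y :=
  GRing.isZmodMorphism.Build _ _ (@alpha_fam Y) (@alpha_fam_is_additive Y).

(** Regrouped by target, the two contributions of each arrow x -> y into Y cancel, because [of_up_i]
    maps n at x and its image at y to the same element. *)
Lemma alpha_bd Y (a : arrow_family FM) :
  (forall x y (h : arrow x y), ~ (Y : set X) y -> a x y h = 0) ->
  alpha_fam Y (bd a) = 0.
Proof.
move=> a0; rewrite /alpha_fam /bd.
under eq_bigr do rewrite raddfB !raddf_sum.
rewrite big_split /= (@sum_arrows X _ arrow (fun x y h => of_up Y x (a x y h))).
rewrite -big_split big1 // => y _; rewrite /= -big_split big1 // => x _ /=.
have [Yy|nYy] := pselect ((Y : set X) y).
  by rewrite of_up_i // subrr.
by rewrite a0 // !raddf0 addr0.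
Qed.

Lemma alpha_subproof Y v : sg_set (relators FM Y) v -> alpha_fam Y v = 0.
Proof.
move=> [a a0 va]; rewrite -(alpha_bd a0); apply: eq_bigr => x _.
have [Yx|nYx] := pselect ((Y : set X) x); first by rewrite va.
by rewrite !of_up_out.
Qed.

Definition alpha Y : {additive gb_obj FM Y false -> M Y false} :=
  quot_lift (@alpha_subproof Y).

Lemma alphaE Y v : alpha Y (to_quot (relators FM Y) v) = alpha_fam Y v.
Proof. exact: quot_liftE. Qed.

Lemma beta_i U Y (o : rel_open Y U) m :
  beta (st_i M true o m) = gb_i true o (beta m).
Proof.
by apply: val_inj; apply: fam_ext => x; exact: to_cl_i.
Qed.

Lemma beta_r Y C (c : rel_closed Y C) m :
  beta (st_r M true c m) = gb_r true c (beta m).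
Proof.
apply: val_inj; apply: fam_ext => x /=.
have [Cx|nCx] := pselect ((C : set X) x).
  by rewrite restrict_in //; exact: to_cl_r_closed.
by rewrite restrict_out //; exact: to_cl_out.
Qed.

Lemma alpha_i U Y (o : rel_open Y U) q :
  alpha Y (gb_i false o q) = st_i M false o (alpha U q).
Proof.
elim/quot_ind: q => v; rewrite gb_iE !alphaE /alpha_fam raddf_sum.
apply: eq_bigr => x _ /=; have [Ux|nUx] := pselect ((U : set X) x).
  by rewrite restrict_in // of_up_i_open.
by rewrite restrict_out // raddf0 of_up_out ?raddf0.
Qed.

Lemma alpha_r Y C (c : rel_closed Y C) q :
  alpha C (gb_r false c q) = st_r M false c (alpha Y q).
Proof.
elim/quot_ind: q => v; rewrite gb_rE !alphaE /alpha_fam raddf_sum.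
by apply: eq_bigr => x _ /=; rewrite of_up_r.
Qed.

End Comparison.

(** * Bijectivity of the comparison maps *)

Section ComparisonIso.
Variables (X : finTopologicalType) (T0 : kolmogorov_space X).
Variables (E : EBP_space X) (M : st_module X).
Implicit Types (x y : X) (Y U C K : LC X).

Local Notation UP := (proj1 E).
Local Notation FM := (FB_obj T0 UP M).
Local Notation alpha := (alpha T0 UP M).
Local Notation beta := (beta T0 UP).

Lemma to_cl_self x m : to_cl M (cl x) x m = m.
Proof.
rewrite (to_clE (rel_open_refl (cl x)) (rel_closed_refl (cl x))).
- by rewrite st_r_id st_i_id.
- exact/in_closure1.
- by rewrite setIid.
Qed.

Lemma of_up_self x n : of_up M (up x) x n = n.
Proof.
rewrite (of_upE (rel_open_refl (up x)) (rel_closed_refl (up x))).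
- by rewrite st_r_id st_i_id.
- exact/in_open_hull1.
- by rewrite setIid.
Qed.

(** Here w <= y < x <= z, and nothing lies strictly between w and z. It leaves x -> y as the only
    arrow from [up x] into [cl y]. *)
Lemma arrow_sandwich x y z w : arrow x y -> arrow z w ->
  spec_le x z -> spec_le w y -> z = x /\ w = y.
Proof.
move=> xy /asboolP[[wz nwz] between] xz wy.
have [yx nyx] := arrow_lt xy.
have wyE : w = y.
  apply: contrapT => nwy; apply: between; exists y; split; split=> //.
    exact: spec_le_trans xz.
  by move=> yz; apply: nyx; apply: spec_le_anti => //; rewrite yz.
split=> //; apply: contrapT => nzx; apply: between; exists x.
by split; split=> //; rewrite ?wyE // => xzE; apply: nzx.
Qed.

(** By [arrow_sandwich] the double sum over points and arrows has the single term at x -> y, which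
    is the boundary map of M itself. *)
Lemma st_d_arrow x y (h : arrow x y) (b : boundary_pair (up x) (cl y)) m :
  alpha (up x) (gb_d true b (beta m)) = st_d M true b m.
Proof.
rewrite alphaE /= /alpha_fam (bigD1 x) //= [X in _ + X]big1 ?addr0.
  rewrite /dl (bigD1 (exist _ y h)) //= [X in _ + X]big1 ?addr0.
    rewrite of_up_self /beta_fam to_cl_self.
    by congr (st_d M true _ _); exact: Prop_irrelevance.
  move=> [w hw] /eqP nw /=.
  rewrite /beta_fam to_cl_out ?raddf0 // => /in_closure1 wy; apply: nw.
  by apply: val_inj => /=; exact: (arrow_sandwich h hw (@spec_le_refl _ _)
    wy).2.
move=> z /eqP nzx; have [xz|nxz] := pselect (spec_le x z); last first.
  by rewrite of_up_out // => /in_open_hull1.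
rewrite /dl big1 ?raddf0 // => -[w hw] _ /=.
rewrite /beta_fam to_cl_out ?raddf0 // => /in_closure1 wy; apply: nzx.
by have [] := arrow_sandwich h hw xz wy.
Qed.

Lemma st_d_comparison U C (b : boundary_pair U C) m :
  alpha U (gb_d true b (beta m)) = st_d M true b m.
Proof.
pose d C U (b : boundary_pair U C) : {additive M C true -> M U false} :=
  st_d M true b \- (alpha U \o gb_d true b \o @beta M C).
have dE C' U' (b' : boundary_pair U' C') m' :
    d C' U' b' m' = st_d M true b' m' - alpha U' (gb_d true b' (beta m')) by [].
apply/esym/eqP; rewrite -subr_eq0 -dE; apply/eqP.
apply: (@d_vanish X T0 M (proj2 E) d).
- move=> {b m}U {}C C' b oC b' m; rewrite !dE.
  by rewrite (st_id b oC b') beta_i (gb_id b oC b').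
- move=> {b m}U {}C U' b cU b' m; rewrite !dE raddfB.
  by rewrite [X in X - _](st_dr b cU b') -(alpha_r cU) [X in alpha U' X](gb_dr
    (j := true) b cU b').
- move=> Y Z W WY WZ WYE WZE lY cY cW lZ oZ oW WYZ {}b o c b' {}m.
  rewrite !dE raddfB -(alpha_i o).
  rewrite [X in X - _](st_di WYE WZE lY cY cW lZ oZ oW WYZ b o c b').
  by rewrite [X in alpha Z X](gb_di (j := true) WYE WZE cY cW oZ oW WYZ b o c
    b') beta_r.
- by move=> x y h {}b {}m; rewrite dE st_d_arrow // subrr.
Qed.

Hypotheses (exM : st_exact M) (rrzl : st_real_rank_zero_like M).

Definition comparison_iso Y :=
  [/\ forall m, beta m = 0 -> m = 0 :> M Y true,
    forall g, exists m : M Y true, beta m = g,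
    forall q, alpha Y q = 0 -> q = 0 & forall m, exists q, alpha Y q = m].

Lemma comparison_iso0 Y : Y = set0 :> set X -> comparison_iso Y.
Proof.
move=> Y0; split=> [m _|g|q _|m].
- exact: st_set0.
- exists 0; rewrite raddf0; exact/esym/(@st_set0 _ (GB_obj FM) true Y g Y0).
- exact: (@st_set0 _ (GB_obj FM) false Y q Y0).
- exists 0; rewrite raddf0; exact/esym/(@st_set0 _ M false Y m Y0).
Qed.

Lemma to_cl_pt u m : to_cl M (pt T0 u) u m = st_i M true (pt_rel_open T0 u) m.
Proof.
rewrite (to_clE (pt_rel_open T0 u) (rel_closed_refl (pt T0 u))) //.
  by rewrite st_r_id.
by rewrite /= setIidl // => z ->; exact/in_closure1.
Qed.

Lemma of_up_pt u n :
  of_up M (pt T0 u) u n = st_r M false (pt_rel_closed T0 u) n.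
Proof.
rewrite (of_upE (rel_open_refl (pt T0 u)) (pt_rel_closed T0 u)) //.
  by rewrite st_i_id.
by rewrite /= setIidl // => z ->; exact/in_open_hull1.
Qed.

Lemma alpha_pt u v :
  alpha (pt T0 u) (to_quot (relators FM (pt T0 u)) v) =
  st_r M false (pt_rel_closed T0 u) (v u).
Proof.
rewrite alphaE /alpha_fam (bigD1 u) //= big1 ?addr0; first exact: of_up_pt.
by move=> z /eqP zu; rewrite of_up_out // => /zu.
Qed.

(** The six-term sequences make M at the point the kernel of restriction from [cl u] to [pcl] in
    degree 1 and the cokernel of extension from [pup] to [up u] in degree 0, where [rrzl] gives
    injectivity and surjectivity. The splittings of [pcl] and [pup] turn these into sections and
    relators at the point. *)
Lemma comparison_iso_pt u : comparison_iso (pt T0 u).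
Proof.
have exC := exM (pt_rel_open T0 u) (pcl_rel_closed T0 u) (pt_pcl T0 UP u)
  (pcl_compl T0 u).
have exU := exM (pup_rel_open T0 u) (pt_rel_closed T0 u) (pup_pt T0 UP u)
  (pt_compl T0 u).
split=> [m|g|q|m].
- move=> /(congr1 (fun g => val g u)) /=; rewrite /beta_fam to_cl_pt => im0.
  have [_ _ /(_ m)] := exC false.
  by case=> /(_ im0)[k <-] _; rewrite rrzl.
- have [k kE] : exists k, st_i M true (pt_rel_open T0 u) k = val g u.
    have [/(_ (val g u)) ex _ _] := exC true; apply/ex.
    rewrite -[LHS](pcl_split UP) big1 // => y _.
    rewrite (st_rr _ _ (arrow_rel_closed (valP y))).
    rewrite [X in st_i _ _ _ X](_ : _ = 0) ?raddf0 //.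
    rewrite [LHS](section_r g (valP y)) //; apply: (section_out g) => /= yu.
    exact: arrow_neq (valP y) yu.
  exists k; apply: val_inj; apply: fam_ext => x /=; rewrite /beta_fam.
  have [->|nxu] := pselect (x = u); first by rewrite to_cl_pt kE.
  by rewrite to_cl_out //; apply/esym/(section_out g).
- elim/quot_ind: q => v; rewrite alpha_pt => rv0.
  have [/(_ (v u)) ex _ _] := exU false.
  have [b bE] := iffLR ex rv0.
  apply/to_quot_eq0.
  (* The preimage b on [pup] splits over the arrows ending at u; its components are the relator
     values, negated because incoming arrows enter [bd] with a minus sign. *)
  exists (fun x y _ => if pselect (arrow x u /\ y = u) is left h
    then - st_r M false (pup_closed_up T0 UP h.1) b else 0).
    by move=> x y h nyu; case: pselect => // -[].
  move=> w ->; rewrite -bE /bd [X in X - _]big1 ?sub0r; last first.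
    move=> y _; case: pselect => // yu.
    by case: (arrow_neq (valP y)); case: yu.
  rewrite -{1}(pup_split UP b) raddf_sum -sumrN; apply: eq_bigr => z _.
  case: pselect => [h|nh]; last by case: nh; split=> //; exact: (valP z).
  rewrite !raddfN opprK (Prop_irrelevance h.1 (valP z)).
  exact: (st_ii (pup_open_up T0 UP (valP z)) (pup_rel_open T0 u)
    (arrow_rel_open (valP z))).
- have [_ /(_ m) ex _] := exU false.
  have [n rn] := iffLR ex (rrzl _ _).
  exists (to_quot (relators FM (pt T0 u))
    (dfwith (fun x => 0 : b0 FM x) (n : b0 FM u) : fam (b0 FM))).
  by rewrite alpha_pt dfwith_in.
Qed.

(** The four chases of the five lemma; [st_d_comparison] is the commutativity of the square with the
    boundary maps. *)
Lemma comparison_iso_step U Y C (o : rel_open Y U) (c : rel_closed Y C)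
    (b : boundary_pair U C) : C = Y `\` U :> set X ->
  comparison_iso U -> comparison_iso C -> comparison_iso Y.
Proof.
move=> CE [bU bU' aU aU'] [bC bC' aC aC'].
have ex1 := exM o c b CE true; have ex0 := exM o c b CE false.
split=> [m m0|g|q q0|m].
- have rm0 : st_r M true c m = 0 by apply: bC; rewrite beta_r m0 raddf0.
  have [/(_ m)[/(_ rm0)[u um] _] _ _] := ex1.
  rewrite -um (bU u) ?raddf0 //; move: m0; rewrite -um beta_i.
  exact: gb_i_inj.
- have [k kE] := bC' (gb_r true c g).
  have [s sE] : exists s, st_r M true c s = k.
    have [_ /(_ k) ex _] := ex1; apply/ex.
    by rewrite -st_d_comparison kE [X in alpha _ X](gb_dr0 o c b CE) raddf0.
  have [w wE] : exists w, gb_i true o w = g - beta s.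
    by apply: (gb_exact_mid1 o CE); rewrite raddfB /= -beta_r sE kE subrr.
  have [u uE] := bU' w.
  by exists (s + st_i M true o u); rewrite raddfD /= beta_i uE wE addrCA subrr
    addr0.
- have rq0 : gb_r false c q = 0 by apply: aC; rewrite alpha_r q0 raddf0.
  have [w wE] := gb_exact_mid0 o CE rq0.
  have [s sE] : exists s, st_d M true b s = alpha U w.
    have [_ _ /(_ (alpha U w)) ex] := ex1; apply/ex.
    by rewrite -[LHS]alpha_i wE.
  have -> : q = gb_i false o (gb_d true b (beta s)).
    rewrite -wE; congr (gb_i false o _); apply/eqP; rewrite -subr_eq0;
      apply/eqP.
    by apply: aU; rewrite raddfB st_d_comparison sE subrr.
  exact: (gb_i_d0 o c b CE).
- have [k kE] := aC' (st_r M false c m).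
  have [g gE] := gb_r_surj c k.
  have [w wE] : exists w, st_i M false o w = m - alpha Y g.
    have [/(_ (m - alpha Y g)) ex _ _] := ex0; apply/ex.
    by rewrite raddfB /= -alpha_r gE kE subrr.
  have [u uE] := aU' w.
  by exists (g + gb_i false o u); rewrite raddfD alpha_i uE wE addrCA subrr
    addr0.
Qed.

Lemma comparison_isoP Y : comparison_iso Y.
Proof.
have [n] := ubnP (card_set Y); elim: n Y => // n IH Y; rewrite ltnS => Yn.
have [[y0 Yy0]|Y0] := pselect (exists y, (Y : set X) y); last first.
  by apply: comparison_iso0; rewrite -subset0 => y Yy; apply: Y0; exists y.
(* A maximal point is open in Y, so Y is obtained from the point u and the smaller set Y \ u. *)
have [u Yu umax] := maximal_point T0 Yy0.
have o : rel_open Y (pt T0 u).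
  apply: rel_open_up => [z -> //|a e Ye /= -> ue].
  by apply: contrapT => neu; apply: (umax e Ye); split=> // /esym.
have c := rel_closed_compl o.
pose C := MkLC (rel_closed_lc (lc_setP Y) c).
have b : boundary_pair (pt T0 u) C.
  exists Y; split=> //; [exact: lc_setP|by move=> z []|].
  rewrite /C /= setDD; apply/seteqP; split=> [z ->|z [] //].
  by split.
apply: (comparison_iso_step o (C := C) c b erefl);
  first exact: comparison_iso_pt.
apply: IH; apply: leq_trans Yn; apply: (@card_set_lt _ _ _ u) => //.
  by move=> z [].
by case=> _; apply.
Qed.

End ComparisonIso.

(** * Functoriality and the equivalence *)

Lemma additive_inverse (U V : zmodType) (f : {additive U -> V}) :
  (forall u, f u = 0 -> u = 0) -> (forall v, exists u, f u = v) ->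
  exists g : {additive V -> U}, cancel f g /\ cancel g f.
Proof.
move=> f_inj f_surj.
have [g fg] : {g : V -> U | forall v, f (g v) = v}.
  exists (fun v => xget 0 [set u | f u = v]) => v.
  by case: xgetP => // /(_ _) nu; have [u uv] := f_surj v; case: (nu u).
have gf : cancel f g.
  move=> u; apply/eqP; rewrite -subr_eq0; apply/eqP/f_inj.
  by rewrite raddfB /= fg subrr.
have gB : zmod_morphism g.
  move=> u v; apply/eqP; rewrite -subr_eq0; apply/eqP/f_inj.
  by rewrite (raddfB f) (raddfB f) !fg subrr.
pose G := HB.pack_for {additive V -> U} g (GRing.isZmodMorphism.Build _ _ g gB).
by exists G.
Qed.

(** * Recursion along unique parents *)

Section ExtendAlong.
Variables (X : finTopologicalType) (T : X -> Type) (parent : X -> X -> Prop).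
Variable step : forall p w, parent p w -> T p -> T w.
Hypothesis parent_wf : forall (S : set X) x, S x ->
  exists2 w, S w & forall p, parent p w -> ~ S p.
Hypothesis parent_uniq : forall p p' w, parent p w -> parent p' w -> p = p'.

(** Values are prescribed at points without a parent and transported from the parent elsewhere. In
    the applications the parent is the neighbouring point towards x, unique because paths are. *)
Lemma extend_along (t0 : forall x, T x) : exists t : forall x, T x,
  (forall x, (forall p, ~ parent p x) -> t x = t0 x) /\
  (forall p w (h : parent p w), t w = step h (t p)).
Proof.
(* S is the set of points still to be treated: outside S the recursion already holds, and parents of
   points outside S are outside S. *)
suff ext (S : set X) (m : forall x, T x) :
    (forall p w, ~ S w -> parent p w -> ~ S p) ->
    (forall p w (h : parent p w), ~ S w -> m w = step h (m p)) ->
    exists t : forall x, T x,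
      (forall x, ~ S x \/ (forall p, ~ parent p x) -> t x = m x) /\
      (forall p w (h : parent p w), t w = step h (t p)).
  have [p w /(_ I)//|p w h /(_ I)//|t [tr th]] := ext setT t0.
  by exists t; split=> // x px; apply: tr; right.
have [n] := ubnP (card_set S); elim: n S m => // n IH S m; rewrite ltnS => Sn.
move=> pS mS.
have [[x0 Sx0]|S0] := pselect (exists x, S x); last first.
  by exists m; split=> // p w h; apply: mS => Sw; apply: S0; exists w.
have [w Sw wmin] := parent_wf Sx0.
have [k kE] : exists k : T w, (forall p (h : parent p w), k = step h (m p)) /\
    ((forall p, ~ parent p w) -> k = m w).
  have [[p h]|np] := pselect (exists p, parent p w); last first.
    by exists (m w); split=> // p h; case: np; exists p.
  exists (step h (m p)); split=> [p' h'|/(_ p)//].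
  have pp' := parent_uniq h h'; move: h'; rewrite -pp' => h'.
  by rewrite (Prop_irrelevance h h').
pose m1 : forall x, T x := dfwith m k.
have m1w : m1 w = k by rewrite /m1 dfwith_in.
have m1x x : x <> w -> m1 x = m x.
  by move=> /eqP xw; rewrite /m1 dfwith_out // eq_sym.
have nSw x : ~ S x -> x <> w by move=> nSx xw; apply: nSx; rewrite xw.
have [|p v nSv pv|p v h nSv|t [tr th]] := IH (S `\ w) m1.
- by apply: leq_trans Sn; apply: card_set_lt Sw => [x []|[_]] //; apply.
- have [vw|nvw] := pselect (v = w).
    by move: pv; rewrite vw => /wmin nSp [].
  by move=> [Sp _]; apply: (pS p v) => // Sv; apply: nSv.
- have [vw|nvw] := pselect (v = w).
    move: h nSv; rewrite vw => h _; rewrite m1w (kE.1 p h) m1x //.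
    exact/nSw/wmin.
  have nSv' : ~ S v by move=> Sv; apply: nSv.
  by rewrite !m1x ?(mS p v h) //; apply: nSw; exact: pS h.
exists t; split=> // x [nSx|rx].
  by rewrite tr ?m1x //; [exact: nSw|left=> -[]].
rewrite tr; last by right.
have [xw|nxw] := pselect (x = w); last exact: m1x.
by move: rx; rewrite xw m1w => rw; exact: kE.2.
Qed.

End ExtendAlong.

(** * Families supported at one point *)

Section Single.
Variables (X : finTopologicalType) (T : X -> zmodType).

Definition single x (n : T x) : fam T := dfwith (fun y => 0 : T y) n.

Lemma single_in x (n : T x) : single n x = n.
Proof. exact: dfwith_in. Qed.

Lemma single_out x y (n : T x) : y <> x -> single n y = 0.
Proof. by move=> /eqP yx; rewrite /single dfwith_out // eq_sym. Qed.

Fact single_is_additive x : zmod_morphism (@single x).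
Proof.
move=> m n; apply: fam_ext => y; rewrite famB.
have [->|nyx] := pselect (y = x); first by rewrite !single_in.
by rewrite !single_out ?subr0.
Qed.

HB.instance Definition _ x :=
  GRing.isZmodMorphism.Build _ _ (@single x) (@single_is_additive x).

Lemma sum_single (v : fam T) : v = \sum_x single (v x).
Proof.
apply: fam_ext => y.
have famsum (I : finType) (F : I -> fam T) z : (\sum_i F i) z = \sum_i F i z.
  by elim/big_rec2: _ => // i y1 y2 _ <-; rewrite famD.
rewrite famsum (bigD1 y) //= single_in big1 ?addr0 // => z /eqP zy.
by rewrite single_out // => yz; apply: zy.
Qed.

End Single.

(** * The functor G on homomorphisms *)

Section GBHom.
Variables (X : finTopologicalType) (N N' : b_module X) (f : b_hom N N').

Definition fam_map (T T' : X -> zmodType) (g : forall x, {additive T x -> T' x})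
  (v : fam T) : fam T' := fun x => g x (v x).

Fact fam_map_is_additive (T T' : X -> zmodType)
    (g : forall x, {additive T x -> T' x}) :
  zmod_morphism (fam_map g).
Proof. by move=> u v; apply: fam_ext => x; rewrite famB /fam_map famB raddfB.
  Qed.

HB.instance Definition _ (T T' : X -> zmodType)
    (g : forall x, {additive T x -> T' x}) :=
  GRing.isZmodMorphism.Build _ _ (fam_map g) (fam_map_is_additive g).

Lemma fam_map_restrict (T T' : X -> zmodType)
    (g : forall x, {additive T x -> T' x}) U v :
  fam_map g (restrict U v) = restrict U (fam_map g v).
Proof.
apply: fam_ext => x; rewrite /fam_map; have [Ux|nUx] := pselect (U x).
  by rewrite !restrict_in.
by rewrite !restrict_out ?raddf0.
Qed.

Lemma sections_map Y m : sections_pred Y m ->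
  sections_pred Y (fam_map (b_fun1 f) m).
Proof.
move=> [m0 mr]; split=> [x nYx|x y h Yx]; rewrite /fam_map.
  by rewrite m0 ?raddf0.
by rewrite -b_fun_r mr.
Qed.

Lemma bd_map (a : arrow_family N) w :
  b_fun0 f w (bd a w) = bd (fun x y (h : arrow x y) => b_fun0 f x (a x y h)) w.
Proof.
rewrite /bd raddfB; congr (_ - _); rewrite raddf_sum //.
by apply: eq_bigr => z _; rewrite b_fun_i.
Qed.

Lemma relators_map Y v : relators_pred Y v ->
  relators_pred Y (fam_map (b_fun0 f) v).
Proof.
move=> [a a0 va]; exists (fun x y h => b_fun0 f x (a x y h)) => [x y h nYy|w
  Yw].
  by rewrite a0 ?raddf0.
by rewrite /fam_map va // bd_map.
Qed.

Definition gb_fun (Y : LC X) (j : bool) :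
    {additive gb_obj N Y j -> gb_obj N' Y j} :=
  match j with
  | true => @sub_map _ _ (sections N Y) (sections N' Y) (fam_map (b_fun1 f))
      (@sections_map Y)
  | false => @quot_map _ _ (relators N Y) (relators N' Y) (fam_map (b_fun0 f))
      (@relators_map Y)
  end.

Lemma gb_funE (Y : LC X) v :
  gb_fun Y false (to_quot (relators N Y) v) =
  to_quot (relators N' Y) (fam_map (b_fun0 f) v).
Proof. exact: quot_mapE. Qed.

Program Definition GB_hom : st_hom (GB_obj N) (GB_obj N') :=
  @STHom X (GB_obj N) (GB_obj N') gb_fun _ _ _.
Next Obligation.
move=> U Y [] h m; first exact: val_inj.
elim/quot_ind: m => v.
rewrite [X in gb_fun _ _ X](gb_iE h) [X in _ = gb_i _ _ X]gb_funE [RHS]gb_iE.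
by rewrite gb_funE fam_map_restrict.
Qed.
Next Obligation.
move=> Y C [] h m.
  by apply: val_inj; rewrite /= fam_map_restrict.
elim/quot_ind: m => v.
rewrite [X in gb_fun _ _ X](gb_rE h) [X in _ = gb_r _ _ X]gb_funE [RHS]gb_rE.
by rewrite gb_funE.
Qed.
Next Obligation.
move=> C U [] h m; last by rewrite /= raddf0.
rewrite [LHS]gb_funE /=; congr to_quot; apply: fam_ext => w.
rewrite /fam_map /dl raddf_sum; apply: eq_bigr => y _.
by rewrite b_fun_d.
Qed.

End GBHom.

(** * The values of G(N) at [cl x] and [up x] *)

Section Evaluation.
Variables (X : finTopologicalType) (T0 : kolmogorov_space X).
Variables (UP : unique_path_space X) (N : b_module X) (x : X).
Implicit Types (y z w p : X).

(** A maximal point where m is non-zero would lie strictly below x and be the target of an arrow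
    from a point of [cl x] where m vanishes. *)
Lemma eval_inj (m : gb_obj N (cl x) true) : val m x = 0 -> m = 0.
Proof.
move=> mx0; apply: val_inj; apply: fam_ext => w /=; apply: contrapT => nmw.
have [v /= nmv vmax] := maximal_point T0 (S := [set w | val m w <> 0]) nmw.
have vx : spec_le v x.
  by apply: contrapT => nvx; apply: nmv; apply: (section_out m) => /in_closure1.
have [vxE|nvx] := pselect (v = x); first by apply: nmv; rewrite vxE.
have [z zv zx] := arrow_below T0 (conj vx nvx).
apply: nmv; rewrite -(section_r m zv); last exact/in_closure1.
rewrite (_ : val m z = 0) ?raddf0 //; apply: contrapT => nmz.
exact: vmax nmz (arrow_lt zv).
Qed.

(** Each point strictly below x is the target of a unique arrow from a point of [cl x], so n is
    carried downward by [extend_along]. *)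
Lemma eval_surj (n : b1 N x) : exists m : gb_obj N (cl x) true, val m x = n.
Proof.
have [||t [tr th]] := @extend_along X (b1 N)
  (fun p w => arrow p w /\ spec_le p x) (fun p w h t => b_r N h.1 t) _ _
  (dfwith (fun y => 0 : b1 N y) n).
- move=> S y /(maximal_point T0)[w Sw wmax]; exists w => // p [/arrow_lt wp _]
  Sp.
  exact: wmax Sp wp.
- move=> p p' w [pw px] [p'w p'x]; exact: arrow_below_inj pw p'w px p'x.
have tsec : sg_set (sections N (cl x)) t.
  split=> [y nyx|y z h /in_closure1 yx]; last first.
    by rewrite (th y z (conj h yx)) (Prop_irrelevance (conj h yx).1 h).
  rewrite tr; last first.
    move=> p [py px]; apply: nyx; apply/in_closure1.
    exact: spec_le_trans (arrow_le py) px.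
  rewrite dfwith_out //; apply/eqP => xy; apply: nyx; rewrite xy.
  exact/in_closure1.
exists (to_sub tsec); rewrite /= tr ?dfwith_in // => p [/arrow_lt[xp nxp] px].
by apply: nxp; exact: spec_le_anti.
Qed.

Lemma to_quot_single (Y : set X) z y (h : arrow z y) (n : b0 N z) : Y y ->
  to_quot (relators N Y) (single n) =
  to_quot (relators N Y) (single (b_i N h n)).
Proof.
move=> Yy; apply: to_quot_eq.
(* This arrow family is n on z -> y and zero on all other arrows. *)
exists (fun u v _ => if v == y then single n u else 0).
  by move=> u v _ nYv; case: eqP => // vy; rewrite vy in nYv.
move=> w _; rewrite famB /bd; congr (_ - _).
  have [wz|nwz] := pselect (w = z); last first.
    by rewrite single_out // big1 // => v _; case: ifP.
  rewrite wz (bigD1 (exist _ y h)) //= eqxx big1 ?addr0 // => v nv.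
  by case: eqP => // vy; case/eqP: nv; exact: val_inj.
have [->|nwy] := pselect (w = y); last first.
  rewrite single_out // big1 // => v _.
  by case: eqP => // _; rewrite raddf0.
rewrite single_in (bigD1 (exist _ z h)) //= eqxx single_in big1 ?addr0.
  by rewrite [valP _](bool_irrelevance _ h).
move=> v nv; rewrite single_out ?raddf0 // => vz; case/eqP: nv; exact: val_inj.
Qed.

(** [phi z] is the composite of the maps i along the unique path between z and x, and zero if x is
    not below z. *)
Let up_maps : exists phi : forall z, {additive b0 N z -> b0 N x},
  [/\ forall n, phi x n = n, forall z n, ~ spec_le x z -> phi z n = 0 &
   forall u z (h : arrow u z) n, spec_le x z -> phi u n = phi z (b_i N h n)].
Proof.
have [||t [tr th]] := @extend_along X (fun z => {additive b0 N z -> b0 N x})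
  (fun p w => arrow w p /\ spec_le x p) (fun p w h t => t \o b_i N h.1) _ _
  (dfwith (fun y => \0 : {additive b0 N y -> b0 N x})
    (idfun : {additive b0 N x -> b0 N x})).
- move=> S y /(minimal_point T0)[w Sw wmin]; exists w => // p [/arrow_lt wp _]
  Sp.
  exact: wmin Sp wp.
- move=> p p' w [pw px] [p'w p'x]; exact: arrow_above_inj pw p'w px p'x.
exists t; split=> [n|z n nxz|u z h n xz].
- rewrite tr ?dfwith_in // => p [/arrow_lt[px npx] xp].
  by apply: npx; exact: spec_le_anti.
- rewrite tr ?dfwith_out //; first by apply/eqP => xz; apply: nxz; rewrite -xz.
  by move=> p [zp xp]; apply: nxz; exact: spec_le_trans xp (arrow_le zp).
- by rewrite (th _ _ (conj h xz)) (Prop_irrelevance (conj h xz).1 h).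
Qed.

Definition coeval (n : b0 N x) : gb_obj N (up x) false :=
  to_quot (relators N (up x)) (single n).

Fact coeval_is_additive : zmod_morphism coeval.
Proof. by move=> u v; rewrite /coeval !raddfB. Qed.

HB.instance Definition _ :=
  GRing.isZmodMorphism.Build _ _ coeval coeval_is_additive.

(** The sum of all [phi z] kills the relators on [up x] and sends [single n] back to n. *)
Lemma coeval_inj n : coeval n = 0 -> n = 0.
Proof.
have [phi [phix phi0 phi_i]] := up_maps.
move=> /to_quot_eq0[a a0 na].
have xx : (up x : set X) x by exact/in_open_hull1.
have PhiE v : \sum_z phi z (single (v : b0 N x) z) = v.
  rewrite (bigD1 x) //= single_in phix big1 ?addr0 // => z /eqP zx.
  by rewrite single_out ?raddf0.
rewrite -(PhiE n).
transitivity (\sum_z phi z (bd a z)).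
  apply: eq_bigr => z _; have [xz|nxz] := pselect (spec_le x z).
    by rewrite na //; exact/in_open_hull1.
  by rewrite !phi0.
rewrite /bd; under eq_bigr do rewrite raddfB !raddf_sum.
rewrite big_split /= (@sum_arrows X _ arrow (fun z y h => phi z (a z y h))).
rewrite -big_split big1 // => y _; rewrite /= -big_split big1 // => z _ /=.
have [xy|nxy] := pselect (spec_le x y).
  by rewrite (phi_i _ _ (valP z)) // subrr.
by rewrite a0 ?raddf0 ?addr0 // => /in_open_hull1.
Qed.

Lemma coeval_surj q : exists n, coeval n = q.
Proof.
have [phi [phix phi0 phi_i]] := up_maps.
(* Each class at z is moved along the path down to x; a minimal counterexample z contradicts one
   step of [to_quot_single]. *)
have phiE z (n : b0 N z) :
    to_quot (relators N (up x)) (single n) = coeval (phi z n).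
  have [xz|nxz] := pselect (spec_le x z); last first.
    rewrite phi0 // raddf0 -[RHS](raddf0 (to_quot (relators N (up x)))).
    apply: to_quot_ext => w /in_open_hull1 xw; rewrite single_out //.
    by move=> wz; apply: nxz; rewrite -wz.
  apply: contrapT => bad.
  pose S : set X := [set z | spec_le x z /\ exists n : b0 N z,
    to_quot (relators N (up x)) (single n) <> coeval (phi z n)].
  have [|w [xw [k kbad]] wmin] := @minimal_point X T0 S z; first by split=> //;
    exists n.
  have [wx|nxw] := pselect (x = w).
    by move: k kbad; rewrite -wx => k; rewrite phix.
  have [p wp xp] := arrow_above T0 (conj xw nxw).
  apply: kbad; rewrite (to_quot_single wp); last exact/in_open_hull1.
  rewrite (phi_i _ _ wp) //; apply: contrapT => pbad.
  apply: (wmin p) (arrow_lt wp); split=> //.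
  by exists (b_i N wp k).
elim/quot_ind: q => v; exists (\sum_z phi z (v z)).
rewrite [in RHS](sum_single v) !raddf_sum; apply: eq_bigr => z _.
exact/esym/phiE.
Qed.

End Evaluation.

(** * Isomorphism criteria and the functor G *)

Section Isomorphisms.
Variable X : finTopologicalType.

Lemma st_hom_iso (M N : ModST X) (f : hom M N) :
  (forall (Y : LC X) j, exists g : {additive st_obj N Y j -> st_obj M Y j},
     cancel (st_fun f Y j) g /\ cancel g (st_fun f Y j)) -> is_iso f.
Proof.
move=> inv.
have g Y j : {g : {additive st_obj N Y j -> st_obj M Y j} |
    cancel (st_fun f Y j) g /\ cancel g (st_fun f Y j)} by exact/cid/inv.
have fK Y j : cancel (st_fun f Y j) (sval (g Y j)) by have [] := svalP (g Y j).
have gK Y j : cancel (sval (g Y j)) (st_fun f Y j) by have [] := svalP (g Y j).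
unshelve eexists (@STHom X N M (fun Y j => sval (g Y j)) _ _ _).
- by move=> U Y j h m; apply: (can_inj (fK _ _)); rewrite st_fun_i !gK.
- by move=> Y C j h m; apply: (can_inj (fK _ _)); rewrite st_fun_r !gK.
- by move=> C U j h m; apply: (can_inj (fK _ _)); rewrite st_fun_d !gK.
by split; apply: st_hom_eq => Y j m /=; rewrite ?fK ?gK.
Qed.

Lemma b_hom_iso (M N : ModB X) (f : hom M N) :
  (forall x, exists g : {additive b1 N x -> b1 M x},
     cancel (b_fun1 f x) g /\ cancel g (b_fun1 f x)) ->
  (forall x, exists g : {additive b0 N x -> b0 M x},
     cancel (b_fun0 f x) g /\ cancel g (b_fun0 f x)) -> is_iso f.
Proof.
move=> inv1 inv0.
have g1 x : {g : {additive b1 N x -> b1 M x} |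
  cancel (b_fun1 f x) g /\ cancel g (b_fun1 f x)} by exact/cid/inv1.
have g0 x : {g : {additive b0 N x -> b0 M x} |
  cancel (b_fun0 f x) g /\ cancel g (b_fun0 f x)} by exact/cid/inv0.
have f1K x : cancel (b_fun1 f x) (sval (g1 x)) by have [] := svalP (g1 x).
have g1K x : cancel (sval (g1 x)) (b_fun1 f x) by have [] := svalP (g1 x).
have f0K x : cancel (b_fun0 f x) (sval (g0 x)) by have [] := svalP (g0 x).
have g0K x : cancel (sval (g0 x)) (b_fun0 f x) by have [] := svalP (g0 x).
unshelve eexists (@BHom X N M (fun x => sval (g1 x)) (fun x => sval (g0 x)) _ _
  _).
- by move=> x y h m; apply: (can_inj (f1K _)); rewrite b_fun_r !g1K.
- by move=> x y h m; apply: (can_inj (f0K _)); rewrite b_fun_d g1K g0K.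
- by move=> x y h m; apply: (can_inj (f0K _)); rewrite b_fun_i !g0K.
by split; apply: b_hom_eq => x m /=; rewrite ?f1K ?g1K ?f0K ?g0K.
Qed.

Program Definition GB : functor (ModB X) (ModST X) :=
  @Functor (ModB X) (ModST X) (@GB_obj X) (@GB_hom X) _ _.
Next Obligation.
move=> N; apply: st_hom_eq => Y [] m; first by apply: val_inj; exact: fam_ext.
by elim/quot_ind: m => v; rewrite [LHS]gb_funE.
Qed.
Next Obligation.
move=> N N' N'' f g; apply: st_hom_eq => Y [] m; first by apply: val_inj;
  exact: fam_ext.
elim/quot_ind: m => v.
rewrite [LHS]gb_funE; apply: esym.
transitivity (gb_fun g Y false (gb_fun f Y false (to_quot (relators N Y) v)))
  => //.
by rewrite !gb_funE.
Qed.

End Isomorphisms.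

(** * The natural isomorphism from F(G(N)) to N *)

Section EvaluationIso.
Variables (X : finTopologicalType) (T0 : kolmogorov_space X).
Variables (UP : unique_path_space X) (N : b_module X).
Implicit Types x y : X.

Definition eval x (m : gb_obj N (cl x) true) : b1 N x := val m x.

Fact eval_is_additive x : zmod_morphism (@eval x).
Proof. by []. Qed.

HB.instance Definition _ x :=
  GRing.isZmodMorphism.Build _ _ (@eval x) (@eval_is_additive x).

(** In degree 0 the explicit map [coeval] starts from N; its inverse has the same direction as
    [eval]. *)
Definition coeval_inv x :=
  cid (additive_inverse (@coeval_inj X T0 UP N x) (@coeval_surj X T0 UP N x)).

Lemma coevalK x : cancel (@coeval X N x) (sval (coeval_inv x)).
Proof. by have [] := svalP (coeval_inv x). Qed.

Lemma coeval_invK x : cancel (sval (coeval_inv x)) (@coeval X N x).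
Proof. by have [] := svalP (coeval_inv x). Qed.

Program Definition eval_hom : b_hom (FB_obj T0 UP (GB_obj N)) N :=
  @BHom X (FB_obj T0 UP (GB_obj N)) N eval (fun x => sval (coeval_inv x)) _ _ _.
Next Obligation.
move=> x y h m; transitivity (restrict (cl y) (val (m : gb_obj N (cl x) true))
  y) => //.
rewrite restrict_in; last exact/in_closure1.
by rewrite (section_r m h) //; exact/in_closure1.
Qed.
Next Obligation.
move=> x y h m; rewrite -[RHS]coevalK; apply: (congr1 (sval (coeval_inv x))).
apply: to_quot_ext => w /in_open_hull1 xw; rewrite /= /dl.
have vanish (z : {z | arrow w z}) : ~ (w = x /\ val z = y) -> val m (val z) = 0.
  move=> nxy; apply: (section_out m) => /in_closure1 zy; apply: nxy.
  exact: (arrow_sandwich T0 h (valP z) xw zy).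
have [wx|nwx] := pselect (w = x); last first.
  by rewrite single_out // big1 // => z _; rewrite vanish ?raddf0 // => -[].
move: xw vanish; rewrite wx single_in => _ vanish.
rewrite (bigD1 (exist _ y h)) //= [X in _ + X]big1 ?addr0.
  by rewrite [valP _](bool_irrelevance _ h).
move=> z /eqP nz; rewrite vanish ?raddf0 // => -[_ zy].
by apply: nz; exact: val_inj.
Qed.
Next Obligation.
move=> x y h m; rewrite -{1}[m]coeval_invK -[RHS]coevalK;
  apply: (congr1 (sval (coeval_inv y))).
rewrite [LHS]gb_iE /= /coeval -(to_quot_single h); last exact/in_open_hull1.
apply: to_quot_ext => w _; have [xw|nxw] := pselect (open_hull [set x] w).
  by rewrite restrict_in.
rewrite restrict_out // single_out // => wx; apply: nxw; rewrite wx.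
exact/in_open_hull1.
Qed.

Lemma eval_hom_iso : @is_iso (ModB X) _ _ eval_hom.
Proof.
apply: b_hom_iso => x; last first.
  exists (@coeval X N x); split; [exact: coeval_invK|exact: coevalK].
apply: additive_inverse; first exact: eval_inj.
exact: eval_surj.
Qed.

End EvaluationIso.

(** * The natural isomorphism from G(F(M)) to M *)

Section ComparisonHom.
Variables (X : finTopologicalType) (T0 : kolmogorov_space X).
Variables (E : EBP_space X).
Local Notation UP := (proj1 E).

Section Hom.
Variable M : st_module X.
Hypotheses (exM : st_exact M) (rrzl : st_real_rank_zero_like M).
Local Notation FM := (FB_obj T0 UP M).

Let beta_inv (Y : LC X) : {g : {additive gb_obj FM Y true -> M Y true} |
  cancel (@beta X T0 UP M Y) g /\ cancel g (@beta X T0 UP M Y)}.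
Proof.
apply: cid; have [i s _ _] := comparison_isoP T0 E exM rrzl Y.
exact: additive_inverse.
Qed.

Lemma betaK (Y : LC X) : cancel (@beta X T0 UP M Y) (sval (beta_inv Y)).
Proof. by have [] := svalP (beta_inv Y). Qed.

Lemma beta_invK (Y : LC X) : cancel (sval (beta_inv Y)) (@beta X T0 UP M Y).
Proof. by have [] := svalP (beta_inv Y). Qed.

(** The maps [beta] and [alpha] point in opposite directions, so [beta] is inverted to give one
    homomorphism. *)
Definition comparison_fun (Y : LC X) j : {additive gb_obj FM Y j -> M Y j} :=
  match j with
  | true => sval (beta_inv Y)
  | false => alpha T0 UP M Y
  end.

Program Definition comparison_hom : st_hom (GB_obj FM) M :=
  @STHom X (GB_obj FM) M comparison_fun _ _ _.
Next Obligation.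
move=> U Y [] h m; last exact: alpha_i.
by apply: (can_inj (@betaK _)); rewrite /= beta_i !beta_invK.
Qed.
Next Obligation.
move=> Y C [] h m; last exact: alpha_r.
by apply: (can_inj (@betaK _)); rewrite /= beta_r !beta_invK.
Qed.
Next Obligation.
move=> C U [] h m; last by rewrite rrzl /= raddf0.
rewrite -{1}[m](@beta_invK C); exact: st_d_comparison.
Qed.

Lemma comparison_hom_iso : @is_iso (ModST X) _ _ comparison_hom.
Proof.
apply: st_hom_iso => Y [] /=.
  by exists (@beta X T0 UP M Y); split; [exact: beta_invK|exact: betaK].
have [_ _ i s] := comparison_isoP T0 E exM rrzl Y.
exact: additive_inverse.
Qed.

End Hom.

Lemma comparison_natural (M M' : st_module X) (f : st_hom M M') exM rrzl exM'
  rrzl' :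
  st_hom_comp (GB_hom (FB_hom T0 UP f)) (@comparison_hom M' exM' rrzl') =
  st_hom_comp (@comparison_hom M exM rrzl) f.
Proof.
apply: st_hom_eq => Y [] m.
  apply: (can_inj (@betaK M' exM' rrzl' Y)); rewrite /= beta_invK.
  apply: val_inj; apply: fam_ext => x; rewrite /= /beta_fam /fam_map /=.
  rewrite -{1}[m](@beta_invK M exM rrzl Y) /= /beta_fam.
  rewrite /to_cl; case: pselect => [Yx|nYx]; last by rewrite raddf0.
  by rewrite /= st_fun_i st_fun_r.
elim/quot_ind: m => v.
transitivity (alpha T0 UP M' Y (gb_fun (FB_hom T0 UP f) Y false
    (to_quot (relators (FB_obj T0 UP M) Y) v))) => //.
transitivity (f Y false (alpha T0 UP M Y (to_quot (relators (FB_obj T0 UP M) Y)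
  v))) => //.
rewrite gb_funE !alphaE /alpha_fam raddf_sum; apply: eq_bigr => x _ /=.
rewrite /of_up; case: pselect => [Yx|nYx]; last by rewrite raddf0.
by rewrite /fam_map /= st_fun_i st_fun_r.
Qed.

End ComparisonHom.

Lemma eval_natural (X : finTopologicalType) (T0 : kolmogorov_space X)
    (UP : unique_path_space X) (N N' : b_module X) (f : b_hom N N') :
  b_hom_comp (FB_hom T0 UP (GB_hom f)) (eval_hom T0 UP N') =
  b_hom_comp (eval_hom T0 UP N) f.
Proof.
apply: b_hom_eq => x m //.
rewrite -{1}[m](@coeval_invK X T0 UP N x) -[RHS](@coevalK X T0 UP N' x).
apply: (congr1 (sval (coeval_inv T0 UP N' x))).
rewrite [LHS]gb_funE; congr to_quot; apply: fam_ext => y.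
rewrite /fam_map; have [->|nyx] := pselect (y = x); first by rewrite !single_in.
by rewrite !single_out ?raddf0.
Qed.

Theorem theorem5p17 (X : finTopologicalType) (X_T0 : kolmogorov_space X)
    (X_EBP : EBP_space X) :
  restricts_to_equivalence (FB X_T0 (proj1 X_EBP))
    (fun M : st_module X => st_exact M /\ st_real_rank_zero_like M)
    (fun N : b_module X => b_exact N).
Proof.
pose PQ (M : ModST X) (PM : st_exact M /\ st_real_rank_zero_like M) :
    b_exact (FB X_T0 (proj1 X_EBP) M) := FB_obj_exact (proj1 PM).
pose QP (N : ModB X) (QN : b_exact N) :
    st_exact (GB X N) /\ st_real_rank_zero_like (GB X N) :=
  conj (GB_obj_exact X_T0 QN) (GB_obj_rrzl (N := N)).
exists PQ, (functor_restrict QP); split.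
- exists (fun M => comparison_hom X_T0 X_EBP
    (proj1 (svalP M)) (proj2 (svalP M))).
  split=> [M|M M' f]; last exact: comparison_natural.
  exact: comparison_hom_iso.
- exists (fun N => eval_hom X_T0 (proj1 X_EBP) (sval N)).
  split=> [N|N N' f]; last exact: eval_natural.
  exact: eval_hom_iso.
Qed.
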